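(* Let $\tau_t(n)$ denote the maximum number of rainbow $t$-cliques in an almost $t$-Gallai colouring of $E(K_n)$. Then: (i) for every fixed $t \ge 3$, $\tau_t(n) = o(n^2)$ as $n \to \infty$; (ii) for every fixed $t \ge 4$, $\tau_t(n) \ge n^{2-o(1)}$ as $n \to \infty$. Moreover, the lower bound in (ii) is attained by almost $t$-Gallai colourings of $E(K_n)$ that use only $\binom{t}{2}$ colours.
   Context: For an integer $t \ge 3$, a colouring $c : E(K_n) \to \mathbb{N}$ of the edges of the complete graph $K_n$ is called almost $t$-Gallai if no two rainbow $t$-cliques share an edge, where a $t$-clique is rainbow if its $\binom{t}{2}$ edges receive pairwise distinct colours. *)

(* Defs.v *)
From Stdlib Require Import Reals.
From mathcomp Require Import all_boot.
Set Implicit Arguments. Unset Strict Implicit. Unset Printing Implicit Defensive.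

(* Vertices of K_n are 'I_n; an edge is a 2-element subset of vertices.
   An edge colouring of K_n is a map c : {set 'I_n} -> nat, of which only the
   values on 2-element sets (the edges) matter. *)

Section Gallai.
Variable n : nat.
Implicit Types (c : {set 'I_n} -> nat) (S : {set 'I_n}).

Definition edges_of S : {set {set 'I_n}} := [set e in powerset S | #|e| == 2].

Definition all_edges : {set {set 'I_n}} := edges_of setT.

Definition rainbow c S : bool :=
  [forall e in edges_of S, forall f in edges_of S, (c e == c f) ==> (e == f)].

Definition rainbow_clique (t : nat) c S : bool := (#|S| == t) && rainbow c S.

Definition share_edge S S' : bool :=
  [exists e, (e \in edges_of S) && (e \in edges_of S')].

Definition almost_gallai (t : nat) c : Prop :=
  forall S S', rainbow_clique t c S -> rainbow_clique t c S' ->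
    S != S' -> ~~ share_edge S S'.

Definition num_rainbow (t : nat) c : nat :=
  #|[set S : {set 'I_n} | rainbow_clique t c S]|.

Definition num_colours c : nat := size (undup [seq c e | e <- enum all_edges]).

End Gallai.

(* Main.v *)
(** Upper bound. Send each colour to a random subset of ['I_t] and keep the
    rainbow cliques [v_1, ..., v_t] in which the colour of [v_i v_j] is sent to
    [{i, j}]: a constant proportion survives for a suitable choice.  The edges
    sent to their own pair form a [t]-partite graph all of whose [t]-cliques are
    rainbow, so that each edge lies in at most one of them and there are at most
    [n^2] of them.  If there were more than [n^2 / q], regularizing the graph and
    discarding the edges in irregular, sparse or small cells would leave a clique
    in good cells, and counting in these cells gives a constant times [n^t]
    cliques, which exceeds [n^2].

    Lower bound. As in Behrend's construction, take the lines
    [(x, x + a, ..., x + (t - 1) a)] with [x] in a box of Z^k and [a] on a sphere;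
    strict convexity of the sphere forbids triangles spread over several lines.
    Give the [i]-th and [j]-th points of a line the colour [{i, j}], and every
    other pair the colour [{0, 1}].  A rainbow [t]-clique uses each colour once,
    so all its edges but one are line edges; as [t >= 4], two of its vertices
    avoid the exceptional edge, and every other vertex forms with them a triangle
    of line edges, hence lies on their line. *)

Require Import Defs.
From Stdlib Require Import Reals Lra.
From mathcomp Require Import all_boot all_order all_algebra.
Set Implicit Arguments. Unset Strict Implicit. Unset Printing Implicit Defensive.

(** * Asymptotic estimates *)

(** The construction occupies [t * (t * d) ^ k] vertices; the largest [d] that fits leaves [n]
    within a constant factor of [d ^ k] once [d] is positive. *)
Lemma largest_scale (t k n : nat) : 0 < t -> 0 < k ->
  exists d, t * (t * d) ^ k <= n /\ n < t * (t * d.+1) ^ k.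
Proof.
move=> t0 k0; pose P d := t * (t * d) ^ k <= n.
have exP : exists d, P d by exists 0; rewrite /P muln0 exp0n // muln0.
have ubP d : P d -> d <= n.
  move=> h; apply: leq_trans h.
  have [->//|d0] := posnP d.
  apply: (@leq_trans ((t * d) ^ k)); last by rewrite leq_pmull.
  apply: (@leq_trans (t * d)); first by rewrite leq_pmull.
  by rewrite -{1}[t * d]expn1 leq_pexp2l // muln_gt0 t0.
case: (ex_maxnP exP ubP) => d Pd dmax; exists d; split=> //.
by rewrite ltnNge; apply/negP => h; have := dmax _ h; rewrite ltnn.
Qed.

Lemma INR_expn (m k : nat) : INR (m ^ k) = pow (INR m) k.
Proof. by elim: k => [|k IH] //; rewrite expnS mult_INR IH. Qed.

Section RealBounds.
Local Open Scope R_scope.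

Lemma Rpower_scale_bound (n C d eps : R) (k : nat) :
  1 <= n -> 1 <= C -> 1 <= d -> 4 <= INR k * eps -> (2 < k)%N ->
  n <= C * d ^ k -> Rpower n (2 - eps) * d ^ 4 <= C ^ 2 * (d ^ k) ^ 2.
Proof.
move=> n1 C1 d1 keps k3 nd.
have kR : 2 < INR k by move/ltP/lt_INR: k3 => /=; lra.
have d4 : d ^ 4 = Rpower d 4.
  by rewrite -(Rpower_pow 4 d) /=; [congr Rpower; lra | lra].
have dk : d ^ k = Rpower d (INR k) by rewrite Rpower_pow //; lra.
(* The exponent for which [Rpower (d ^ k) a * d ^ 4] is exactly [(d ^ k) ^ 2]; it is at least
   [2 - eps] because [4 <= INR k * eps]. *)
pose a := 2 - 4 / INR k.
have a0 : 0 <= a.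
  rewrite /a; suff : 4 / INR k <= 2 by lra.
  apply: (Rmult_le_reg_r (INR k)); first lra.
  by rewrite /Rdiv Rmult_assoc Rinv_l; lra.
have le_a : 2 - eps <= a.
  rewrite /a; suff : 4 / INR k <= eps by lra.
  apply: (Rmult_le_reg_r (INR k)); first lra.
  by rewrite /Rdiv Rmult_assoc Rinv_l; lra.
have Cd0 : 0 < C * d ^ k by apply: Rmult_lt_0_compat; [lra | apply: pow_lt; lra].
have s1 : Rpower n (2 - eps) <= Rpower (C * d ^ k) a.
  apply: (Rle_trans _ (Rpower n a)).
    case: (Req_dec n 1) => [->|nn1]; first by rewrite /Rpower ln_1 !Rmult_0_r; lra.
    by apply: Rle_Rpower; lra.
  by apply: Rle_Rpower_l; lra.
have s2 : Rpower (C * d ^ k) a = Rpower C a * Rpower (d ^ k) a.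
  by rewrite Rpower_mult_distr //; [lra | apply: pow_lt; lra].
have s3 : Rpower C a <= C ^ 2.
  have -> : C ^ 2 = Rpower C 2.
    by rewrite -(Rpower_pow 2 C) /=; [congr Rpower; lra | lra].
  case: (Req_dec C 1) => [->|nn1]; first by rewrite /Rpower ln_1 !Rmult_0_r; lra.
  apply: Rle_Rpower; first lra.
  rewrite /a; suff : 0 < 4 / INR k by lra.
  by apply: Rdiv_lt_0_compat; lra.
have s4 : Rpower (d ^ k) a * d ^ 4 = (d ^ k) ^ 2.
  rewrite d4 dk Rpower_mult -Rpower_plus -(Rpower_pow 2); last exact: exp_pos.
  rewrite Rpower_mult; congr Rpower; rewrite /a /=; field; lra.
have p0 : 0 <= (d ^ k) ^ 2 by apply: pow_le; apply: pow_le; lra.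
have d40 : 0 <= d ^ 4 by apply: pow_le; lra.
apply: (Rle_trans _ (Rpower C a * Rpower (d ^ k) a * d ^ 4)).
  by rewrite -s2; apply: Rmult_le_compat_r.
rewrite Rmult_assoc s4; exact: Rmult_le_compat_r.
Qed.


Lemma INR_leq (m n : nat) : (m <= n)%N -> INR m <= INR n.
Proof. by move=> /leP; exact: le_INR. Qed.

Lemma INR_ge1 (n : nat) : (0 < n)%N -> 1 <= INR n.
Proof. exact: (@INR_leq 1). Qed.

(** Passing to one sphere costs a factor [k * d ^ 2] and the choice of scale costs [C ^ 2]. As
    [C * k <= d], the total loss is at most [d ^ 4], which the [eps] in the exponent absorbs. *)
Lemma rainbow_count_bound (n C d k m : nat) (eps : R) :
  (0 < n)%N -> (0 < C)%N -> (0 < d)%N -> (C * k <= d)%N -> (2 < k)%N ->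
  4 <= INR k * eps -> (n <= C * d ^ k)%N ->
  (d ^ k * d ^ k <= m * (k * d ^ 2))%N -> Rpower (INR n) (2 - eps) <= INR m.
Proof.
move=> n0 C0 d0 Ckd k3 keps nCd cnt.
have d1 := INR_ge1 d0; have C1 := INR_ge1 C0.
have k1 := INR_ge1 (ltnW (ltnW k3)).
have := INR_leq nCd; rewrite mult_INR INR_expn => {}nCd.
have := INR_leq Ckd; rewrite mult_INR => {}Ckd.
have := INR_leq cnt; rewrite !mult_INR !INR_expn => {}cnt.
have := Rpower_scale_bound (INR_ge1 n0) C1 d1 keps k3 nCd.
move: cnt; set D := INR d ^ k; set A := Rpower _ _ => cnt h.
have m0 := pos_INR m.
have d2 : 0 < INR d ^ 2 by apply: pow_lt; lra.
apply: (Rmult_le_reg_r (INR d ^ 2 * INR d ^ 2)); first exact: Rmult_lt_0_compat.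
have -> : INR d ^ 2 * INR d ^ 2 = INR d ^ 4 by ring.
apply: (Rle_trans _ _ _ h).
apply: (Rle_trans _ (INR C ^ 2 * (INR m * (INR k * INR d ^ 2)))).
  apply: Rmult_le_compat_l; first by apply: pow_le; lra.
  have -> : D ^ 2 = D * D by ring.
  by have -> : INR d ^ 2 = INR d * INR d by ring.
have -> : INR C ^ 2 * (INR m * (INR k * INR d ^ 2)) =
  INR m * ((INR C ^ 2 * INR k) * INR d ^ 2) by ring.
have -> : INR d ^ 4 = INR d ^ 2 * INR d ^ 2 by ring.
apply: Rmult_le_compat_l => //; apply: Rmult_le_compat_r; first lra.
apply: (Rle_trans _ ((INR C * INR k) ^ 2)); last by apply: pow_incr; nra.
have -> : (INR C * INR k) ^ 2 = INR C ^ 2 * INR k * INR k by ring.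
rewrite -[X in X <= _]Rmult_1_r; apply: Rmult_le_compat_l => //.
by apply: Rmult_le_pos; [apply: pow_le; lra | lra].
Qed.

Lemma INR_mul_ge (A eps : R) : 0 < eps ->
  exists k : nat, (2 < k)%N /\ A <= INR k * eps.
Proof.
move=> eps0; have [m mA] := INR_unbounded (A / eps).
exists (m + 3)%N; split; first by rewrite addn3.
apply: (Rle_trans _ (A / eps * eps)).
  by rewrite /Rdiv Rmult_assoc Rinv_l; lra.
by apply: Rmult_le_compat_r; [lra | rewrite plus_INR /=; lra].
Qed.

Lemma INR_le_eps_sqr (q m n : nat) (eps : R) : 1 <= INR q * eps ->
  (m * q <= n ^ 2)%N -> INR m <= eps * INR n ^ 2.
Proof.
move=> qe /INR_leq; rewrite mult_INR INR_expn => h.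
have q0 := pos_INR q; have m0 := pos_INR m.
have e0 : 0 < eps by nra.
by apply: (Rle_trans _ (INR m * (INR q * eps))); nra.
Qed.

End RealBounds.

From mathcomp Require Import ring lra zify.
Import Order.TTheory GRing.Theory Num.Theory.

(** * Regularity lemma *)

Section CondExp.
Local Open Scope ring_scope.
Variables (F : realFieldType) (Z : finType) (f : Z -> F).

(** The conditional expectation of [f] given [P], with value 0 on an empty fibre; [energy] is its
    squared L2 norm. *)
Definition fibre_avg (K : finType) (P : Z -> K) (k : K) : F :=
  (\sum_(z | P z == k) f z) / #|[set z | P z == k]|%:R.

Definition energy (K : finType) (P : Z -> K) : F :=
  \sum_z fibre_avg P (P z) ^+ 2.

Lemma fibre_avg_sum (K : finType) (P : Z -> K) (h : K -> F) :
  \sum_z f z * h (P z) = \sum_z fibre_avg P (P z) * h (P z).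
Proof.
rewrite (partition_big P xpredT) //= [RHS](partition_big P xpredT) //=.
apply: eq_bigr => k _.
rewrite (eq_bigr (fun z => f z * h k)); last by move=> z /eqP ->.
rewrite -mulr_suml [RHS](eq_bigr (fun=> fibre_avg P k * h k)); last first.
  by move=> z /eqP ->.
rewrite sumr_const -mulr_natl mulrA; congr (_ * _).
rewrite /fibre_avg cardsE; set N := #|_|.
have [N0|N0] := eqVneq N 0%N.
  rewrite N0 mul0r big_pred0 // => z; apply/negP => Pz.
  by have : (P z == k) = false := card0_eq N0 z; rewrite Pz.
by rewrite mulrC mulfVK // pnatr_eq0.
Qed.

Lemma fibre_avg_ge0 (K : finType) (P : Z -> K) k :
  (forall z, 0 <= f z) -> 0 <= fibre_avg P k.
Proof. by move=> f0; rewrite divr_ge0 ?ler0n // sumr_ge0. Qed.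

Lemma fibre_avg_le1 (K : finType) (P : Z -> K) k :
  (forall z, f z <= 1) -> fibre_avg P k <= 1.
Proof.
move=> f1; rewrite /fibre_avg cardsE; set N := #|_|.
have [N0|N0] := eqVneq N 0%N; first by rewrite N0 invr0 mulr0.
rewrite ler_pdivrMr ?ltr0n ?lt0n // mul1r -[N]sum1_card natr_sum.
exact: ler_sum.
Qed.

Lemma energy_ge0 (K : finType) (P : Z -> K) : 0 <= energy P.
Proof. by apply: sumr_ge0 => z _; exact: sqr_ge0. Qed.

Lemma energy_le (K : finType) (P : Z -> K) :
  (forall z, 0 <= f z <= 1) -> energy P <= #|Z|%:R.
Proof.
move=> f01; rewrite -sum1_card natr_sum; apply: ler_sum => z _.
rewrite expr_le1 ?fibre_avg_ge0 ?fibre_avg_le1 // => y;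
  by case/andP: (f01 y).
Qed.

(** Pythagoras: the coarser average is a function of the finer class, so the cross term collapses to
    [energy P]. *)
Lemma energy_refine (K K' : finType) (P : Z -> K) (P' : Z -> K') (r : K' -> K) :
  (forall z, P z = r (P' z)) ->
  energy P' = energy P + \sum_z (fibre_avg P' (P' z) - fibre_avg P (P z)) ^+ 2.
Proof.
move=> Pr.
have cross : \sum_z fibre_avg P' (P' z) * fibre_avg P (P z) = energy P.
  rewrite (eq_bigr (fun z => fibre_avg P' (P' z) * (fibre_avg P \o r) (P' z)));
    last by move=> z _ /=; rewrite Pr.
  rewrite -(fibre_avg_sum P') (eq_bigr (fun z => f z * fibre_avg P (P z)));
    last by move=> z _ /=; rewrite Pr.
  by rewrite fibre_avg_sum; apply: eq_bigr => z _; rewrite expr2.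
have -> : \sum_z (fibre_avg P' (P' z) - fibre_avg P (P z)) ^+ 2 =
  \sum_z (fibre_avg P' (P' z) ^+ 2 + fibre_avg P (P z) ^+ 2
          - (fibre_avg P' (P' z) * fibre_avg P (P z)) *+ 2).
  by apply: eq_bigr => z _; ring.
rewrite big_split big_split /= -!/(energy _) sumrN sumrMnl cross.
ring.
Qed.

(** Cauchy-Schwarz against the constant 1, read off from the nonnegative sum of the
    [(N * D z - s) ^+ 2]. *)
Lemma sum_sqr_ge (S : pred Z) (D : Z -> F) :
  (\sum_(z | S z) D z) ^+ 2 <= #|S|%:R * \sum_(z | S z) D z ^+ 2.
Proof.
set s := \sum_(z | S z) D z; set Q := \sum_(z | S z) _.
set N : F := #|S|%:R.
have : 0 <= \sum_(z | S z) (N * D z - s) ^+ 2.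
  by apply: sumr_ge0 => z _; exact: sqr_ge0.
have -> : \sum_(z | S z) (N * D z - s) ^+ 2 =
   \sum_(z | S z) (N ^+ 2 * D z ^+ 2 + (- (N * s *+ 2) * D z + s ^+ 2)).
  by apply: eq_bigr => z _; ring.
rewrite big_split big_split /= sumr_const -!mulr_sumr -/s -/Q.
rewrite -[X in _ + (_ + X)]mulr_natl.
rewrite -/N => ge; have [N0|N0] := eqVneq #|S| 0%N.
  have -> : s = 0.
    rewrite /s big_pred0 // => z; exact: (card0_eq N0 z).
  by rewrite expr0n /= /N N0 mul0r.
have N_gt0 : 0 < N by rewrite ltr0n lt0n.
move: ge; have -> : N ^+ 2 * Q + (- (N * s *+ 2) * s + N * s ^+ 2) =
          N * (N * Q - s ^+ 2) by ring.
by rewrite pmulr_rge0 // subr_ge0.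
Qed.

(** The witness [S k] is a union of classes of [P'], so it cannot tell [f] from its finer average.
    The discrepancy it detects is thus one between the two averages, and Cauchy-Schwarz turns it
    into a gain of [eps ^+ 2] per element of the cell. *)
Lemma energy_increment (K K' : finType) (P : Z -> K) (P' : Z -> K')
    (r : K' -> K) (B : pred K) (S : K -> K' -> bool) (eps : F) :
  (forall z, P z = r (P' z)) -> 0 <= eps ->
  (forall k, B k -> eps * #|[set z | P z == k]|%:R <=
     `|\sum_(z | (P z == k) && S k (P' z)) (f z - fibre_avg P k)|) ->
  energy P + eps ^+ 2 * #|[set z | B (P z)]|%:R <= energy P'.
Proof.
move=> Pr eps0 irr; rewrite (energy_refine Pr) lerD2l.
pose D z := fibre_avg P' (P' z) - fibre_avg P (P z).
rewrite -/(D _) -sum1_card natr_sum mulr_sumr.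
rewrite (eq_bigl (fun z => B (P z))); last by move=> z; rewrite inE.
rewrite (partition_big P B) //= (bigID (fun z => B (P z))) /=.
rewrite -[X in X <= _]addr0 lerD //; last first.
  by apply: sumr_ge0 => z _; exact: sqr_ge0.
rewrite [X in _ <= X](partition_big P B) //=; apply: ler_sum => k Bk.
have eqk : (fun z => B (P z) && (P z == k)) =1 (fun z => P z == k).
  by move=> z; apply: andb_idl => /eqP ->.
rewrite !(eq_bigl _ _ eqk) -mulr_sumr -natr_sum sum1_card -cardsE.
set N := #|_|; have := irr k Bk; rewrite -/N => irrk.
have sumD : \sum_(z | (P z == k) && S k (P' z)) (f z - fibre_avg P k) =
            \sum_(z | (P z == k) && S k (P' z)) D z.
  pose h k' : F := ((r k' == k) && S k k')%:R.
  have toh (g : Z -> F) :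
      \sum_(z | (P z == k) && S k (P' z)) g z = \sum_z g z * h (P' z).
    rewrite big_mkcond; apply: eq_bigr => z _; rewrite /h -Pr.
    by case: ifP => _; rewrite ?mulr1 ?mulr0.
  rewrite (eq_bigr (fun z => f z - fibre_avg P (P z))); last first.
    by move=> z /andP[/eqP -> _].
  by rewrite !sumrB; congr (_ - _); rewrite !toh fibre_avg_sum.
have [N0|N_neq0] := eqVneq N 0%N.
  rewrite N0 mulr0; apply: sumr_ge0 => z _; exact: sqr_ge0.
have N_gt0 : 0 < N%:R :> F by rewrite ltr0n lt0n.
rewrite -(ler_pM2l N_gt0).
apply: (@le_trans _ _ ((\sum_(z | (P z == k) && S k (P' z)) D z) ^+ 2)).
  rewrite -sumD -[X in _ <= X]real_normK ?num_real //.
  have -> : N%:R * (eps ^+ 2 * N%:R) = (eps * N%:R) ^+ 2 by ring.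
  by rewrite lerXn2r ?nnegrE ?normr_ge0 ?mulr_ge0 // ltW.
apply: le_trans (sum_sqr_ge _ _) _; apply: ler_pM; rewrite ?ler0n //.
- by apply: sumr_ge0 => z _; exact: sqr_ge0.
- rewrite ler_nat /N cardsE; apply: subset_leq_card; apply/subsetP => z.
  by case/andP.
- rewrite [X in _ <= X](bigID (fun z => S k (P' z))) /= -[X in X <= _]addr0.
  by rewrite lerD // sumr_ge0 // => z _; exact: sqr_ge0.
Qed.

End CondExp.

Section Regularity.
Local Open Scope ring_scope.
Variables (F : realFieldType) (I V : finType) (e : I -> rel V).

Definition edge_val (z : I * (V * V)) : F := (e z.1 z.2.1 z.2.2)%:R.

(** One vertex partition [p] serves all the graphs [e i] at once; the graph index is part of the
    cell. *)
Definition cell_of (k : nat) (p : V -> 'I_k) (z : I * (V * V)) :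
  I * ('I_k * 'I_k) := (z.1, (p z.2.1, p z.2.2)).

(** Discrepancy is measured against the size of the whole cell, as in the cut norm, so [X] and [Y]
    range over all sets, however small. *)
Definition regular_cell (eps : F) (k : nat) (p : V -> 'I_k)
    (w : I * ('I_k * 'I_k)) : bool :=
  [forall X : {set V}, forall Y : {set V},
    `|\sum_(z | (cell_of p z == w) && ((z.2.1 \in X) && (z.2.2 \in Y)))
        (edge_val z - fibre_avg edge_val (cell_of p) w)|
      <= eps * #|[set z | cell_of p z == w]|%:R].

Lemma edge_val01 z : 0 <= edge_val z <= 1.
Proof. by rewrite /edge_val; case: e => /=; rewrite ?lexx ?ler01. Qed.

(** A vertex records its old part and, for each cell, its membership in the two witness sets. The
    size of this type does not depend on the vertex set, which keeps the number of parts uniformly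
    bounded. *)
Definition refined_labels (I' : finType) (k : nat) : finType :=
  ('I_k * {ffun I' * ('I_k * 'I_k) -> bool * bool})%type.

Lemma refine_irregular (eps : F) (k : nat) (p : V -> 'I_k) : 0 <= eps ->
  exists p' : V -> 'I_#|refined_labels I k|,
    energy edge_val (cell_of p)
      + eps ^+ 2 * #|[set z | ~~ regular_cell eps p (cell_of p z)]|%:R
    <= energy edge_val (cell_of p').
Proof.
move=> eps0.
have /fin_all_exists[XY XYP] (w : I * ('I_k * 'I_k)) :
    exists XY : {set V} * {set V}, ~~ regular_cell eps p w ->
     eps * #|[set z | cell_of p z == w]|%:R <=
     `|\sum_(z | (cell_of p z == w) && ((z.2.1 \in XY.1) && (z.2.2 \in XY.2)))
        (edge_val z - fibre_avg edge_val (cell_of p) w)|.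
  have [|] := boolP (regular_cell eps p w); first by exists (set0, set0).
  rewrite negb_forall => /existsP[X]; rewrite negb_forall => /existsP[Y].
  by rewrite -ltNge => lt; exists (X, Y) => _; exact: ltW.
pose lab x : refined_labels I k :=
  (p x, [ffun w => (x \in (XY w).1, x \in (XY w).2)]).
pose p' x := enum_rank (lab x); exists p'.
pose r (w : I * ('I_#|refined_labels I k| * 'I_#|refined_labels I k|)) :=
  (w.1, ((enum_val w.2.1).1, (enum_val w.2.2).1)).
pose S w (w' : I * ('I_#|refined_labels I k| * 'I_#|refined_labels I k|)) :=
  ((enum_val w'.2.1).2 w).1 && ((enum_val w'.2.2).2 w).2.
apply: (energy_increment (r := r) (S := S)
  (B := fun w => ~~ regular_cell eps p w)) => //.
  by case=> i [x y]; rewrite /cell_of /r /= !enum_rankK.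
move=> w /XYP /le_trans -> //.
rewrite le_eqVlt; apply/orP; left; apply/eqP; congr `|_|.
by apply: eq_bigl => -[i [x y]]; rewrite /S /= !enum_rankK /= !ffunE.
Qed.

End Regularity.

Section RegularityLemma.
Local Open Scope ring_scope.

(** Induction on [s], the number of refinements still allowed: refining a partition with too many
    irregular triples gains at least [eps ^+ 3 * #|V|%:R ^+ 2]. *)
Lemma regularity_from_energy (F : realFieldType) (I : finType) (eps : F)
    (s k : nat) : 0 < eps ->
  exists M : nat, forall (V : finType) (e : I -> rel V) (p : V -> 'I_k),
    #|{: I * (V * V)}|%:R - eps ^+ 3 * s%:R * #|V|%:R ^+ 2
      <= energy (edge_val F e) (cell_of p) ->
    exists k' (p' : V -> 'I_k'), (k' <= M)%N /\
      #|[set z | ~~ regular_cell e eps p' (cell_of p' z)]|%:R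
        <= eps * #|V|%:R ^+ 2.
Proof.
move=> eps0; elim: s k => [|s IH] k.
  (* With no refinement left the energy is already maximal, so refining cannot gain and no triple is
     irregular. *)
  exists k => V e p; rewrite mulr0 mul0r subr0 => enp; exists k, p; split=> //.
  have [p' en'] := refine_irregular e p (ltW eps0).
  have := energy_le (cell_of p') (edge_val01 F e).
  move: en'; set B := #|[set _ | _]| => en' en''.
  have : eps ^+ 2 * B%:R <= 0 by lra.
  rewrite pmulr_rle0 ?exprn_gt0 // => B0; apply: le_trans B0 _.
  by rewrite mulr_ge0 ?exprn_ge0 // ltW.
have [M0 M0P] := IH #|refined_labels I k|.
exists (maxn k M0) => V e p enp.
case: (leP #|[set z | ~~ regular_cell e eps p (cell_of p z)]|%:R
           (eps * #|V|%:R ^+ 2)) => [reg|irr].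
  by exists k, p; rewrite leq_maxl.
have [p' en'] := refine_irregular e p (ltW eps0).
case: (M0P V e p') => [|k' [q [k'M reg]]].
  apply: le_trans en'; move: irr; set B := #|[set _ | _]| => irr.
  have : eps ^+ 2 * (eps * #|V|%:R ^+ 2) <= eps ^+ 2 * B%:R.
    by rewrite ler_pM2l ?exprn_gt0 // ltW.
  rewrite -natr1 in enp; move: enp; set X := energy _ _.
  set z := #|_|%:R; set n2 := #|V|%:R ^+ 2 => enp.
  have -> : eps ^+ 2 * (eps * n2) = eps ^+ 3 * n2 by ring.
  have := enp; rewrite mulrDr mulrDl mulr1; lra.
by exists k', q; split=> //; rewrite (leq_trans k'M) ?leq_maxr.
Qed.

Lemma szemeredi_regularity (F : realFieldType) (I : finType) (Q : nat) :
  (0 < Q)%N ->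
  exists M : nat, forall (V : finType) (e : I -> rel V),
    exists k (p : V -> 'I_k), (k <= M)%N /\
      #|[set z | ~~ regular_cell e (Q%:R^-1 : F) p (cell_of p z)]|%:R
        <= Q%:R^-1 * #|V|%:R ^+ 2 :> F.
Proof.
move=> Q0; have Qr : 0 < Q%:R :> F by rewrite ltr0n.
have eps0 : 0 < Q%:R^-1 :> F by rewrite invr_gt0.
(* The energy is at most [#|I| * #|V| ^ 2], so [#|I| * Q ^ 3] gains exhaust it even when starting
   from the one-part partition. *)
have [M MP] := @regularity_from_energy F I _ (#|I| * Q ^ 3) 1 eps0.
exists M => V e; case: (MP V e (fun=> ord0)) => [|k [p ?]]; last by exists k, p.
apply: le_trans (energy_ge0 _ _).
rewrite !card_prod (natrM _ #|I| (Q ^ 3)) natrX !natrM.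
have -> : Q%:R^-1 ^+ 3 * (#|I|%:R * Q%:R ^+ 3) = #|I|%:R :> F.
  by field; rewrite pnatr_eq0 -lt0n.
by rewrite subr_le0 -expr2.
Qed.

End RegularityLemma.

(** * Clique counting and removal *)

Section Counting.
Local Open Scope ring_scope.
Variables (F : realFieldType) (V : finType) (t : nat).
Implicit Types (v : {ffun 'I_t -> V}) (A : 'I_t -> {set V}) (G : {ffun 'I_t -> V} -> F).

Definition upd v (a : 'I_t) (x : V) : {ffun 'I_t -> V} :=
  [ffun i => if i == a then x else v i].

(** Exchanging the coordinates [a] and [b] of [v] with the fresh pair [(x, y)] is an involution of
    the index set. *)
Lemma sum_box_resample A G (a b : 'I_t) : a != b ->
  (\sum_(v in family A) G v) * (#|A a| * #|A b|)%:R =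
  \sum_(v in family A) \sum_(x in A a) \sum_(y in A b) G (upd (upd v a x) b y).
Proof.
move=> ab; have ba : b != a by rewrite eq_sym.
pose C (w : {ffun 'I_t -> V} * (V * V)) :=
  (w.1 \in family A) && ((w.2.1 \in A a) && (w.2.2 \in A b)).
have -> : (\sum_(v in family A) G v) * (#|A a| * #|A b|)%:R =
          \sum_(w | C w) G w.1.
  rewrite mulr_suml -(pair_big (fun v => v \in family A)
    (fun z : V * V => (z.1 \in A a) && (z.2 \in A b)) (fun v _ => G v)) /=.
  apply: eq_bigr => v _; rewrite sumr_const -[RHS]mulr_natr; congr (_ * _%:R).
  by rewrite -cardsX; apply: eq_card => -[x y]; rewrite in_setX.
have -> : \sum_(v in family A) \sum_(x in A a) \sum_(y in A b)
    G (upd (upd v a x) b y) = \sum_(w | C w) G (upd (upd w.1 a w.2.1) b w.2.2).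
  rewrite -(pair_big (fun v => v \in family A)
    (fun z : V * V => (z.1 \in A a) && (z.2 \in A b))
    (fun v z => G (upd (upd v a z.1) b z.2))) /=.
  apply: eq_bigr => v _.
  by rewrite (pair_big _ _ (fun x y => G (upd (upd v a x) b y))).
pose phi (w : {ffun 'I_t -> V} * (V * V)) :=
  (upd (upd w.1 a w.2.1) b w.2.2, (w.1 a, w.1 b)).
have phiK : involutive phi.
  case=> v [x y]; rewrite /phi /=; congr (_, (_, _)).
  - apply/ffunP => i; rewrite !ffunE.
    by case: eqVneq => [->|_] //; case: eqVneq => [->|].
  - by rewrite !ffunE (negPf ab) eqxx.
  - by rewrite !ffunE eqxx.
rewrite (reindex_inj (inv_inj phiK)) /=; apply: eq_bigl => -[v [x y]].
rewrite /C /phi /=; apply/idP/idP.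
  case/andP => /familyP h /andP[va vb].
  have := h a; have := h b; rewrite !ffunE !eqxx (negPf ab) => -> ->.
  rewrite !andbT; apply/familyP => i; have := h i; rewrite !ffunE.
  by case: eqVneq => [->|_] //; case: eqVneq => [->|].
case/andP => /familyP h /andP[xA yA]; rewrite !h !andbT.
apply/familyP => i; rewrite !ffunE.
by case: eqVneq => [->|_] //; case: eqVneq => [->|].
Qed.

Variable e : 'I_t * 'I_t -> rel V.

Definition all_adjacent (L : seq ('I_t * 'I_t)) v :=
  all (fun w => e w (v w.1) (v w.2)) L.

(* Once all coordinates other than [a] and [b] are frozen, the remaining
   constraints split into one on [x] and one on [y]. *)
Lemma all_adjacent_upd (L : seq ('I_t * 'I_t)) v (a b : 'I_t) :
  (a < b)%N -> (a, b) \notin L -> {in L, forall w : 'I_t * 'I_t, (w.1 < w.2)%N} ->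
  exists X Y : {set V}, forall x y,
    all_adjacent L (upd (upd v a x) b y) = (x \in X) && (y \in Y).
Proof.
move=> ab abL ltL.
exists [set x | all (fun w : 'I_t * 'I_t => (w.1 == b) || (w.2 == b)
                   || e w (upd v a x w.1) (upd v a x w.2)) L].
exists [set y | all (fun w : 'I_t * 'I_t => (w.1 == a) || (w.2 == a)
                   || e w (upd v b y w.1) (upd v b y w.2)) L].
move=> x y; rewrite !inE -all_predI; apply: eq_in_all => -[i j] wL.
have /= ij := ltL _ wL; rewrite /= !ffunE.
have nab : ~~ ((i == a) && (j == b)).
  by apply: contra abL => /andP[/eqP <- /eqP <-].
have nba : ~~ ((i == b) && (j == a)).
  by apply/negP => /andP[/eqP hi /eqP hj]; move: ij ab; rewrite hi hj; lia.
have nii : i != j by rewrite neq_ltn ij.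
have abn : a != b by rewrite neq_ltn ab.
move: nab nba.
case: (eqVneq i a) => [ia|ia]; case: (eqVneq i b) => [ib|ib];
case: (eqVneq j a) => [ja|ja]; case: (eqVneq j b) => [jb|jb] //=;
  rewrite ?andbT ?andbb //; subst; rewrite ?eqxx in nii abn *; by [].
Qed.

(** One-sided counting lemma: the edges in [L] are replaced by their densities one at a time. Each
    replacement costs at most [eps] per tuple, and densities at most 1 keep the earlier errors from
    growing. *)
Lemma box_count A (d : 'I_t * 'I_t -> F) (eps : F) (L : seq ('I_t * 'I_t)) :
  0 <= eps -> uniq L -> (forall i, 0 < #|A i|)%N ->
  {in L, forall w : 'I_t * 'I_t, (w.1 < w.2)%N} -> {in L, forall w : 'I_t * 'I_t, 0 <= d w <= 1} ->
  {in L, forall (w : 'I_t * 'I_t) (X Y : {set V}), - (eps * (#|A w.1| * #|A w.2|)%:R) <=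
     \sum_(x in A w.1 | x \in X) \sum_(y in A w.2 | y \in Y)
       ((e w x y)%:R - d w)} ->
  (\prod_(w <- L) d w - (size L)%:R * eps) * #|family A|%:R <=
  \sum_(v in family A) (all_adjacent L v)%:R.
Proof.
move=> eps0 + A0; elim: L => [_ _ _ _|[a b] L IH /= /andP[abL uL] ltL dL regL].
  by rewrite big_nil mul0r subr0 mul1r sumr_const.
have ab : (a < b)%N by apply: (ltL (a, b)); rewrite mem_head.
have sub w : w \in L -> w \in (a, b) :: L by move=> wL; rewrite inE wL orbT.
have ltL' : {in L, forall w : 'I_t * 'I_t, (w.1 < w.2)%N} by move=> w /sub /ltL.
have {}IH : (\prod_(w <- L) d w - (size L)%:R * eps) * #|family A|%:R <=
  \sum_(v in family A) (all_adjacent L v)%:R.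
  by apply: IH => // w /sub; [exact: dL | exact: regL].
set N : F := #|family A|%:R in IH *.
have /andP[d0 d1] := dL (a, b) (mem_head _ _).
have N0 : 0 <= N by rewrite ler0n.
set dab := d (a, b) in d0 d1 *.
have -> : \sum_(v in family A) (all_adjacent ((a, b) :: L) v)%:R =
   \sum_(v in family A) ((e (a, b) (v a) (v b))%:R - dab) * (all_adjacent L v)%:R
   + dab * \sum_(v in family A) (all_adjacent L v)%:R :> F.
  rewrite mulr_sumr -big_split; apply: eq_bigr => v _ /=.
  by rewrite -/(all_adjacent L v) -mulnb natrM; ring.
(* With the other coordinates frozen, the remaining constraints cut out a rectangle [X] by [Y], to
   which the regularity of the pair [(a, b)] applies. *)
have first : - (eps * N) <=
   \sum_(v in family A) ((e (a, b) (v a) (v b))%:R - dab) * (all_adjacent L v)%:R.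
  have abn : a != b by rewrite neq_ltn ab.
  have AA : 0 < (#|A a| * #|A b|)%:R :> F by rewrite ltr0n muln_gt0 !A0.
  rewrite -(ler_pM2r AA) sum_box_resample //.
  have -> : - (eps * N) * (#|A a| * #|A b|)%:R =
    \sum_(v in family A) - (eps * (#|A a| * #|A b|)%:R).
    by rewrite sumr_const -[RHS]mulr_natr -/N; ring.
  apply: ler_sum => v _.
  have [X [Y XY]] := all_adjacent_upd v ab abL ltL'.
  apply: le_trans (regL (a, b) (mem_head _ _) X Y) _.
  rewrite le_eqVlt; apply/orP; left; apply/eqP.
  rewrite big_mkcondr /=; apply: eq_bigr => x _.
  case: ifP => xX; last first.
    by rewrite big1 // => y _; rewrite XY xX mulr0.
  rewrite big_mkcondr /=; apply: eq_bigr => y _.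
  rewrite XY xX /= !ffunE !eqxx (negPf abn).
  by case: ifP => _; rewrite ?mulr1 ?mulr0.
rewrite big_cons /= -natr1.
have /= h := ler_wpM2l d0 IH.
have h2 : dab * ((size L)%:R * eps * N) <= 1 * ((size L)%:R * eps * N).
  by apply: ler_wpM2r => //; rewrite !mulr_ge0 ?ler0n.
apply: le_trans (lerD first h); rewrite -/dab.
move: h2; set P := \prod_(_ <- _) _; set s : F := (size L)%:R => h2.
have -> : (dab * P - (s + 1) * eps) * N =
  dab * P * N - 1 * (s * eps * N) - eps * N by ring.
have -> : - (eps * N) + dab * ((P - s * eps) * N) =
  dab * P * N - dab * (s * eps * N) - eps * N by ring.
by rewrite lerD2r lerD2l lerN2.
Qed.

End Counting.

(** * Sums over cells, sparse cells and small cells *)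

Section CellSums.
Local Open Scope ring_scope.
Variables (F : realFieldType) (I V : finType) (k : nat) (p : V -> 'I_k).

Definition vcell (a : 'I_k) : {set V} := [set x | p x == a].

Lemma sum_cell_of (w : I) (a b : 'I_k) (X Y : {set V})
    (g : I * (V * V) -> F) :
  \sum_(z | (cell_of p z == (w, (a, b))) && ((z.2.1 \in X) && (z.2.2 \in Y))) g z =
  \sum_(x in vcell a | x \in X) \sum_(y in vcell b | y \in Y) g (w, (x, y)).
Proof.
rewrite (pair_big_dep _ _ (fun x y => g (w, (x, y)))) /=.
transitivity (\sum_(i | i == w) \sum_(z : V * V |
   (z.1 \in vcell a) && (z.1 \in X) && ((z.2 \in vcell b) && (z.2 \in Y)))
   g (i, z)); last by rewrite big_pred1_eq; apply: eq_bigr => -[].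
rewrite pair_big_dep /=; apply: eq_big; last by case=> i [x y].
case=> i [x y]; rewrite /cell_of /= !xpair_eqE !inE.
by case: (i == w) => //=; case: (p x == a); case: (p y == b);
  case: (x \in X); case: (y \in Y).
Qed.

Lemma card_cell_of (w : I) (a b : 'I_k) :
  #|[set z | cell_of p z == (w, (a, b))]| = (#|vcell a| * #|vcell b|)%N.
Proof.
rewrite -cardsX -(card_imset (mem (setX (vcell a) (vcell b))) (f := pair w)).
  apply: eq_card => -[i [x y]]; rewrite !inE /cell_of /= !xpair_eqE.
  apply/idP/imsetP.
    case/andP => /eqP -> /andP[xa yb]; exists (x, y) => //.
    by rewrite !inE xa.
  by case=> -[x' y']; rewrite !inE /= => h [-> -> ->]; rewrite eqxx.
by move=> x y [].
Qed.

Lemma regular_cell_lower (e : I -> rel V) (eps : F) (w : I) (a b : 'I_k)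
    (X Y : {set V}) : regular_cell e eps p (w, (a, b)) ->
  - (eps * (#|vcell a| * #|vcell b|)%:R) <=
  \sum_(x in vcell a | x \in X) \sum_(y in vcell b | y \in Y)
    ((e w x y)%:R - fibre_avg (edge_val F e) (cell_of p) (w, (a, b))).
Proof.
move=> /forallP/(_ X)/forallP/(_ Y); rewrite card_cell_of sum_cell_of.
by rewrite ler_norml => /andP[].
Qed.

(** Low density is a property of the cell, so [fibre_avg_sum] lets the density, which is below [d],
    replace each edge indicator there. *)
Lemma card_sparse_edges (e : I -> rel V) (d : F) : 0 <= d ->
  #|[set z | e z.1 z.2.1 z.2.2
      && (fibre_avg (edge_val F e) (cell_of p) (cell_of p z) < d)%R]|%:R
    <= d * #|{: I * (V * V)}|%:R.
Proof.
move=> d0; set av := fibre_avg _ _.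
have -> : #|[set z | e z.1 z.2.1 z.2.2 && (av (cell_of p z) < d)%R]|%:R =
    \sum_z edge_val F e z * (av (cell_of p z) < d)%R%:R.
  rewrite -sum1_card natr_sum big_mkcond /=; apply: eq_bigr => z _.
  by rewrite inE /edge_val -natrM mulnb; case: andb.
rewrite (fibre_avg_sum _ _ (fun c => (av c < d)%R%:R)) -sum1_card natr_sum.
rewrite mulr_sumr; apply: ler_sum => z _; rewrite mulr1 -/av.
by case: ltP => [lt|_]; rewrite ?mulr1 ?mulr0 // ltW.
Qed.

(** There are at most [M] cells, and each small one holds at most a fraction [1 / (M * g)] of the
    vertices. *)
Lemma card_small_cells (M g : nat) : (k <= M)%N -> (0 < M)%N ->
  (#|[set x | #|vcell (p x)| * (M * g) <= #|V|]| * g <= #|V|)%N.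
Proof.
move=> kM M0; rewrite -(leq_pmul2l M0) mulnCA -sum1_card big_distrl /=.
rewrite (eq_bigl (fun x => #|vcell (p x)| * (M * g) <= #|V|)%N); last first.
  by move=> x; rewrite inE.
rewrite (partition_big p xpredT) //=.
apply: (@leq_trans (\sum_(a < k) #|V|)); last first.
  by rewrite sum_nat_const card_ord leq_mul2r kM orbT.
apply: leq_sum => a _.
have [small|big] := leqP (#|vcell a| * (M * g)) #|V|; last first.
  rewrite big_pred0 // => x; apply/negbTE/negP => /andP[h /eqP xa].
  by move: h; rewrite xa leqNgt big.
apply: (leq_trans _ small).
rewrite (eq_bigl (fun x => x \in vcell a)); last first.
  move=> x; rewrite inE; apply: andb_idl => /eqP ->.
  by [].
by rewrite sum_nat_const mul1n.
Qed.

End CellSums.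


(** The parts are [t] copies of [V]: [v i] is the vertex chosen in copy [i], and [v] may repeat a
    value. *)
Definition partite_cliques (V : finType) (t : nat) (e : 'I_t * 'I_t -> rel V) :
    {set {ffun 'I_t -> V}} :=
  [set v : {ffun 'I_t -> V} |
    [forall w : 'I_t * 'I_t, (w.1 < w.2) ==> e w (v w.1) (v w.2)]].

(** * Removal for edge-disjoint partite cliques *)

Section Removal.
Variables (V : finType) (t : nat) (e : 'I_t * 'I_t -> rel V).
Hypothesis t3 : 3 <= t.
Hypothesis uniqC : forall (v v' : {ffun 'I_t -> V}) (w : 'I_t * 'I_t),
  v \in partite_cliques e -> v' \in partite_cliques e ->
  w.1 < w.2 -> v w.1 = v' w.1 -> v w.2 = v' w.2 -> v = v'.
Let T := partite_cliques e.

Lemma card_cliques_le_sqr : #|T| <= #|V| ^ 2.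
Proof.
pose w : 'I_t * 'I_t := (Ordinal (leq_trans (isT : 0 < 3) t3),
                         Ordinal (leq_trans (isT : 1 < 3) t3)).
rewrite -mulnn -card_prod.
rewrite -(card_in_imset (f := fun v : {ffun 'I_t -> V} => (v w.1, v w.2))).
  exact: max_card.
by move=> v v' vT vT' [h h']; exact: (uniqC vT vT' (w := w)).
Qed.

(** By [uniqC] a clique is determined by the edge in [B] that [wit] selects from it, so the
    selection is injective. *)
Lemma card_cliques_le_edges (B : {set ('I_t * 'I_t) * (V * V)}) :
  (forall v, v \in T -> exists w : 'I_t * 'I_t,
      w.1 < w.2 /\ (w, (v w.1, v w.2)) \in B) -> #|T| <= #|B|.
Proof.
move=> hB.
have [->|[v0 v0T]] := set_0Vmem T; first by rewrite cards0.
have [w0 _] := hB v0 v0T.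
pose wit (v : {ffun 'I_t -> V}) := odflt w0
  [pick w : 'I_t * 'I_t | (w.1 < w.2) && ((w, (v w.1, v w.2)) \in B)].
have witP v : v \in T -> (wit v).1 < (wit v).2 /\
    (wit v, (v (wit v).1, v (wit v).2)) \in B.
  move=> /hB [w [w12 wB]]; rewrite /wit; case: pickP => [w' /andP[]|/(_ w)] //=.
  by rewrite w12 wB.
rewrite -(card_in_imset (f := fun v => (wit v, (v (wit v).1, v (wit v).2)))).
  by apply: subset_leq_card; apply/subsetP => _ /imsetP[v /witP[_ h] ->].
move=> v v' vT vT' [h]; rewrite -h => h1 h2.
by apply: (uniqC vT vT' (w := wit v)) => //; case: (witP v vT).
Qed.

Section Partition.
Local Open Scope ring_scope.
Variables (F : realFieldType) (k M D g Q : nat) (p : V -> 'I_k).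
Let av := fibre_avg (edge_val F e) (cell_of p).
Hypothesis kM : (k <= M)%N.
Hypothesis M0 : (0 < M)%N.
Hypothesis D0 : (0 < D)%N.
Hypothesis g0 : (0 < g)%N.

Definition small_cell x := (#|vcell p (p x)| * (M * g) <= #|V|)%N.

Definition bad_edge (z : ('I_t * 'I_t) * (V * V)) : bool :=
  [|| ~~ regular_cell e (Q%:R^-1 : F) p (cell_of p z),
      e z.1 z.2.1 z.2.2 && (av (cell_of p z) < D%:R^-1),
      small_cell z.2.1 | small_cell z.2.2].

Lemma card_bad_edges :
  #|[set z | ~~ regular_cell e (Q%:R^-1 : F) p (cell_of p z)]|%:R
    <= Q%:R^-1 * #|V|%:R ^+ 2 :> F ->
  #|[set z | bad_edge z]|%:R <=
   (Q%:R^-1 + (t ^ 2)%:R * (D%:R^-1 + g%:R^-1 *+ 2)) * #|V|%:R ^+ 2 :> F.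
Proof.
move=> irr.
set B1 := [set z | ~~ _] in irr.
pose B2 := [set z | e z.1 z.2.1 z.2.2 && (av (cell_of p z) < D%:R^-1)].
pose S := [set x | small_cell x].
pose B3 := setX [set: 'I_t * 'I_t] (setX S [set: V]).
pose B4 := setX [set: 'I_t * 'I_t] (setX [set: V] S).
have sub : (#|[set z | bad_edge z]| <= #|B1| + (#|B2| + (#|B3| + #|B4|)))%N.
  apply: (@leq_trans #|B1 :|: (B2 :|: (B3 :|: B4))|).
    apply: subset_leq_card; apply/subsetP => -[w [x y]]; rewrite !inE /bad_edge /=.
    by rewrite !andbT.
  by do 3 (apply: leq_trans (leq_card_setU _ _) _; rewrite leq_add2l).
have cI : #|{: 'I_t * 'I_t}| = (t ^ 2)%N by rewrite card_prod !card_ord.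
have h2 : #|B2|%:R <= (t ^ 2)%:R * D%:R^-1 * #|V|%:R ^+ 2 :> F.
  apply: le_trans (card_sparse_edges _ _ _) _; first by rewrite invr_ge0.
  rewrite card_prod cI card_prod !natrM -expr2.
  by rewrite mulrCA mulrA.
have hS : #|S|%:R <= g%:R^-1 * #|V|%:R :> F.
  rewrite mulrC ler_pdivlMr ?ltr0n // -natrM ler_nat.
  exact: card_small_cells.
have h34 : #|B3|%:R <= (t ^ 2)%:R * g%:R^-1 * #|V|%:R ^+ 2 :> F.
  rewrite !cardsX !cardsT cI (natrM _ (t ^ 2)) (natrM _ #|S|).
  by rewrite -mulrA ler_wpM2l // expr2 mulrA ler_wpM2r.
have e34 : #|B4| = #|B3|.
  by rewrite !cardsX (mulnC #|S|).
apply: (@le_trans _ _ (#|B1|%:R + (#|B2|%:R + (#|B3|%:R + #|B4|%:R)))).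
  by rewrite -!natrD ler_nat.
rewrite e34; move: irr h2 h34.
set a := #|B1|%:R; set b := #|B2|%:R; set c := #|B3|%:R; set n2 := #|V|%:R ^+ 2.
set tt := (t ^ 2)%:R; set qi := Q%:R^-1; set di := D%:R^-1; set gi := g%:R^-1.
move=> ha hb hc.
have -> : (qi + tt * (di + gi *+ 2)) * n2 =
  qi * n2 + (tt * di * n2 + (tt * gi * n2 + tt * gi * n2)) by ring.
by rewrite !lerD.
Qed.

(** The cells around such a clique are large, dense and pairwise regular, so at least a proportion
    [1 / (2 * D ^ (t ^ 2))] of the box they span consists of cliques, while there are at most
    [#|V| ^ 2] cliques in all. *)
Lemma good_clique_bound v : v \in T -> Q = (2 * t ^ 2 * D ^ (t ^ 2))%N ->
  (forall w : 'I_t * 'I_t, (w.1 < w.2)%N -> ~~ bad_edge (w, (v w.1, v w.2))) ->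
  (#|V| ^ t <= 2 * D ^ (t ^ 2) * (M * g) ^ t * #|V| ^ 2)%N.
Proof.
move=> vT QE good.
pose A i := vcell p (p (v i)).
have A0 i : (0 < #|A i|)%N by apply/card_gt0P; exists (v i); rewrite inE.
have goodP (w : 'I_t * 'I_t) : (w.1 < w.2)%N ->
   [/\ regular_cell e (Q%:R^-1 : F) p (w, (p (v w.1), p (v w.2))),
       D%:R^-1 <= av (w, (p (v w.1), p (v w.2))),
       ~~ small_cell (v w.1) & ~~ small_cell (v w.2)].
  move=> w12; have ew : e w (v w.1) (v w.2).
    by move: vT; rewrite inE => /forallP/(_ w)/implyP/(_ w12).
  have := good w w12; rewrite /bad_edge !negb_or negbK /= ew /= -leNgt.
  by case/and4P.
(* Cell sizes are controlled only at endpoints of good pairs: index 0 is paired with 1, and every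
   other index with 0. *)
have bigA i : (#|V| <= #|A i| * (M * g))%N.
  suff : ~~ small_cell (v i) by rewrite /small_cell -ltnNge => /ltnW.
  pose o0 : 'I_t := Ordinal (leq_trans (isT : 0 < 3)%N t3).
  pose o1 : 'I_t := Ordinal (leq_trans (isT : 1 < 3)%N t3).
  have [i0|i0] := posnP i.
    by case: (@goodP (i, o1)) => //=; rewrite i0.
  by case: (@goodP (o0, i)).
pose L := [seq w : 'I_t * 'I_t <- enum {: 'I_t * 'I_t} | (w.1 < w.2)%N].
have LP (w : 'I_t * 'I_t) : w \in L -> (w.1 < w.2)%N by rewrite mem_filter => /andP[].
pose d (w : 'I_t * 'I_t) := av (w, (p (v w.1), p (v w.2))).
have d01 w : 0 <= d w <= 1.
  by apply/andP; split; [apply: fibre_avg_ge0 | apply: fibre_avg_le1] => z;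
    case/andP: (edge_val01 F e z).
have eps0 : 0 <= Q%:R^-1 :> F by rewrite invr_ge0.
have cnt := @box_count F V t e A d Q%:R^-1 L eps0 (filter_uniq _ (enum_uniq _)) A0
  LP (fun w _ => d01 w)
  (fun w wL X Y => @regular_cell_lower F _ V k p e Q%:R^-1 w _ _ X Y
     (let: And4 r _ _ _ := goodP w (LP w wL) in r)).
have sizeL : (size L <= t ^ 2)%N.
  rewrite size_filter (leq_trans (count_size _ _)) //.
  by rewrite -cardE card_prod !card_ord.
have Dr : 0 < D%:R :> F by rewrite ltr0n.
have prodL : (D ^ (t ^ 2))%:R^-1 <= \prod_(w <- L) d w.
  apply: (@le_trans _ _ (\prod_(w <- L) D%:R^-1)).
    rewrite big_const_seq count_predT -/(iterop _ _ _ _) iter_mulr_1 exprVn.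
    rewrite natrX lef_pV2 ?posrE ?exprn_gt0 //.
    by rewrite ler_weXn2l // ler1n.
  rewrite big_seq [X in _ <= X]big_seq; apply: ler_prod => w wL.
  by rewrite invr_ge0 ler0n /=; case: (goodP w (LP w wL)).
have sumT : \sum_(u in family A) (all_adjacent e L u)%:R <= #|T|%:R :> F.
  rewrite -natr_sum ler_nat -sum1_card big_mkcond [X in (_ <= X)%N]big_mkcond /=.
  apply: leq_sum => u _; case: ifP => // _.
  case: (boolP (all_adjacent e L u)) => // /allP adj.
  rewrite ifT // inE; apply/forallP => w; apply/implyP => w12.
  by apply: adj; rewrite mem_filter w12 mem_enum.
set P := (D ^ (t ^ 2))%N in prodL QE *.
have P0 : (0 < P)%N by rewrite expn_gt0 D0.
have Pr : 0 < P%:R :> F by rewrite ltr0n.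
have t20 : 0 < (t ^ 2)%:R :> F by rewrite ltr0n expn_gt0 (leq_trans _ t3).
have sL : (size L)%:R * Q%:R^-1 <= P%:R^-1 / 2 :> F.
  apply: (@le_trans _ _ ((t ^ 2)%:R * Q%:R^-1)).
    by rewrite ler_wpM2r ?ler_nat.
  rewrite QE (natrM _ (2 * t ^ 2)) (natrM _ 2) le_eqVlt; apply/orP; left.
  by apply/eqP; field; rewrite gt_eqF //= pnatr_eq0 -lt0n (leq_trans _ t3).
have boxle : (#|family A| <= 2 * P * #|V| ^ 2)%N.
  rewrite -(ler_nat F) natrM natrM.
  have : P%:R^-1 / 2 * #|family A|%:R <= (#|V| ^ 2)%:R :> F.
    apply: le_trans (le_trans cnt (le_trans sumT _)); last first.
      by rewrite ler_nat card_cliques_le_sqr.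
    rewrite ler_wpM2r ?ler0n //; apply: le_trans (lerB prodL sL).
    by rewrite [X in _ <= X - _]splitr addrK.
  have PP : 0 <= 2 * P%:R :> F by rewrite mulr_ge0.
  move=> /(ler_wpM2l PP); set N := #|family A|%:R.
  have -> // : 2 * P%:R * (P%:R^-1 / 2 * N) = N by field; rewrite gt_eqF.
apply: (@leq_trans (#|family A| * (M * g) ^ t)); last first.
  by rewrite mulnAC leq_mul2r boxle orbT.
rewrite card_family.
have -> : foldr muln 1%N [seq #|A x| | x : 'I_t] = (\prod_(i < t) #|A i|)%N.
  by rewrite foldrE big_map big_enum.
have <- : (\prod_(i < t) (M * g) = (M * g) ^ t)%N by rewrite prod_nat_const card_ord.
have <- : (\prod_(i < t) #|V| = #|V| ^ t)%N by rewrite prod_nat_const card_ord.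
by rewrite -big_split /=; apply: leq_prod => i _; exact: bigA.
Qed.

End Partition.
End Removal.

(** A clique with only good edges would bound [#|V| ^ t] by a constant times [#|V| ^ 2], absurd for
    large [#|V|] since [t >= 3]. Hence every clique has a bad edge, and cliques inject into the few
    bad edges. *)
Lemma few_partite_cliques (t q : nat) : 3 <= t -> 0 < q ->
  exists N, forall (V : finType) (e : 'I_t * 'I_t -> rel V), N <= #|V| ->
  (forall (v v' : {ffun 'I_t -> V}) (w : 'I_t * 'I_t),
    v \in partite_cliques e -> v' \in partite_cliques e ->
    w.1 < w.2 -> v w.1 = v' w.1 -> v w.2 = v' w.2 -> v = v') ->
  #|partite_cliques e| * q <= #|V| ^ 2.
Proof.
move=> t3 q0; have t0 : 0 < t by exact: leq_trans t3.
(* Irregular, sparse and small cells each account for at most [n^2 / 4q] bad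
   edges, and the counting error is half of the main term [1 / P]. *)
pose D := 4 * t ^ 2 * q; pose g := 2 * D.
pose P := D ^ (t ^ 2); pose Q := 2 * t ^ 2 * P.
have t20 : 0 < t ^ 2 by rewrite expn_gt0 t0.
have D0 : 0 < D by rewrite !muln_gt0 q0 t0.
have g0 : 0 < g by rewrite muln_gt0.
have P0 : 0 < P by rewrite expn_gt0 D0.
have Q0 : 0 < Q by rewrite !muln_gt0 P0 t0.
have [M MP] := @szemeredi_regularity rat ('I_t * 'I_t)%type Q Q0.
exists (2 * P * (M.+1 * g) ^ t).+1 => V e bigV uniqC.
have [k [p [kM irr]]] := MP V e.
pose B := [set z | bad_edge e rat M.+1 D g Q p z].
case: (boolP [exists v in partite_cliques e, [forall w : 'I_t * 'I_t,
   (w.1 < w.2) ==> ((w, (v w.1, v w.2)) \notin B)]]) => [|allbad].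
  case/existsP => v /andP[vT /forallP good]; exfalso.
  have h : #|V| ^ t <= 2 * P * (M.+1 * g) ^ t * #|V| ^ 2.
    apply: (good_clique_bound t3 uniqC (F := rat) (p := p) D0 vT (erefl Q)).
    by move=> w w12; have := good w; rewrite w12 inE.
  have n0 : 0 < #|V| by exact: leq_ltn_trans bigV.
  move: h; rewrite -{1}(subnK (ltnW t3)) expnD leq_pmul2r ?expn_gt0 ?n0 //.
  apply/negP; rewrite -ltnNge; apply: (leq_trans bigV).
  by rewrite -{1}[#|V|]expn1 leq_pexp2l // subn_gt0.
have TB : #|partite_cliques e| <= #|B|.
  apply: (card_cliques_le_edges uniqC) => v vT.
  move: allbad; rewrite negb_exists => /forallP/(_ v).
  rewrite vT /= negb_forall => /existsP[w].
  by rewrite negb_imply negbK => /andP[w12 wB]; exists w.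
have Bb : (#|B|%:R <= (Q%:R^-1 + (t ^ 2)%:R * (D%:R^-1 + g%:R^-1 *+ 2))
    * #|V|%:R ^+ 2 :> rat)%R by apply: card_bad_edges => //; exact: leqW.
have qr : (0 < q%:R :> rat)%R by rewrite ltr0n.
have tr : (0 < (t ^ 2)%:R :> rat)%R by rewrite ltr0n.
have Qq : (Q%:R^-1 <= q%:R^-1 / 4 :> rat)%R.
  rewrite -invfM lef_pV2 ?posrE ?mulr_gt0 ?ltr0n // -(natrM _ q 4) ler_nat.
  apply: (@leq_trans D); first by rewrite /D; nia.
  apply: (@leq_trans P); last by rewrite /Q; nia.
  by rewrite /P -{1}[D]expn1 leq_pexp2l.
have Dq : ((t ^ 2)%:R * (D%:R^-1 + g%:R^-1 *+ 2) = q%:R^-1 / 2 :> rat)%R.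
  rewrite /g natrM /D (natrM _ _ q) (natrM _ 4).
  by field; rewrite !pnatr_eq0 -!lt0n q0.
rewrite -(ler_nat rat) natrM natrX -ler_pdivlMr //.
apply: (@le_trans _ _ #|B|%:R%R); first by rewrite ler_nat.
apply: le_trans Bb _; rewrite mulrC ler_wpM2l ?exprn_ge0 // Dq.
have : (0 < q%:R^-1 :> rat)%R by rewrite invr_gt0.
lra.
Qed.

(** * Upper bound *)

Lemma set2_eq (T : finType) (a b c d : T) :
  [set a; b] = [set c; d] -> (a = c /\ b = d) \/ (a = d /\ b = c).
Proof.
move=> h.
have ha : a \in [set c; d] by rewrite -h set21.
have hb : b \in [set c; d] by rewrite -h set22.
have hc : c \in [set a; b] by rewrite h set21.
have hd : d \in [set a; b] by rewrite h set22.
move: ha hb hc hd; rewrite !inE.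
move=> /orP[]/eqP-> /orP[]/eqP->; rewrite ?orbb; auto.
  by move=> _ /eqP ->; auto.
by move=> /eqP -> _; auto.
Qed.

Lemma edgesP (m : nat) (S e : {set 'I_m}) :
  reflect (exists x y, [/\ x \in S, y \in S, x != y & e = [set x; y]])
          (e \in edges_of S).
Proof.
rewrite !inE; apply: (iffP andP) => [[/subsetP sub /cards2P[x [y [xy ee]]]]|].
  by exists x, y; split=> //; apply: sub; rewrite ee ?set21 ?set22.
case=> x [y [xS yS xy ->]]; split; last by rewrite cards2 xy.
by apply/subsetP => z; rewrite !inE => /orP[]/eqP ->.
Qed.

(** A uniformly random [psi] agrees with [h] on [D] with probability 1 over [#|K| ^ #|D|]; the bound
    is written without division. *)
Lemma card_prescribed (C K : finType) (D : {set C}) (h : C -> K) :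
  #|K| ^ #|C| <= #|[set psi : {ffun C -> K} | [forall y in D, psi y == h y]]|
                 * #|K| ^ #|D|.
Proof.
pose S y := if y \in D then [set h y] else [set: K].
have -> : #|[set psi : {ffun C -> K} | [forall y in D, psi y == h y]]| =
          #|family S|.
  apply: eq_card => psi; rewrite inE; apply/forall_inP/familyP => H y.
    by rewrite /S; case: ifP => [/H|_]; rewrite inE.
  by move=> yD; have := H y; rewrite /S yD inE.
rewrite card_family.
have -> : foldr muln 1 [seq #|S x| | x : C] = \prod_(x : C) #|S x|.
  by rewrite foldrE big_map big_enum.
rewrite (bigID (mem D)) /= big1 => [|y yD]; last by rewrite /S yD cards1.
rewrite mul1n (eq_bigr (fun=> #|K|)); last first.
  by move=> y /negPf yD; rewrite /S yD cardsT.
by rewrite prod_nat_const -expnD addnC (cardC (mem D)).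
Qed.

Section UpperBound.
Variables (n t : nat) (c : {set 'I_n} -> nat).
Hypothesis ag : almost_gallai t c.

(** Bounding the colours makes them a finite type, so that maps defined on colours can be averaged
    over. *)
Definition palette := (\max_(e : {set 'I_n}) c e).+1.

Definition colour (e : {set 'I_n}) : 'I_palette := inord (c e).

Lemma colour_inj e f : colour e = colour f -> c e = c f.
Proof. by move=> /(congr1 val); rewrite /= !inordK ?ltnS ?leq_bigmax. Qed.

Definition class_edges (psi : {ffun 'I_palette -> {set 'I_t}})
    (w : 'I_t * 'I_t) : rel 'I_n :=
  fun x y => (x != y) && (psi (colour [set x; y]) == [set w.1; w.2]).

Lemma class_edgesP psi (v : {ffun 'I_t -> 'I_n}) :
  v \in partite_cliques (class_edges psi) ->
  injective v /\
  forall i j, i != j -> psi (colour [set v i; v j]) = [set i; j].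
Proof.
rewrite inE => /forallP h.
have h' i j : i != j -> v i != v j /\ psi (colour [set v i; v j]) = [set i; j].
  rewrite neq_ltn => /orP[] lt.
    by have /implyP/(_ lt)/andP[-> /eqP] := h (i, j).
  have /implyP/(_ lt)/andP[/= vij /eqP] := h (j, i).
  by rewrite eq_sym vij setUC => ->; rewrite setUC.
split=> [i j|i j /h'[]//].
by apply: contra_eq => /h'[].
Qed.

(** [psi] recovers the pair of indices from the colour, so edges of equal colour coincide. *)
Lemma clique_image_rainbow psi (v : {ffun 'I_t -> 'I_n}) :
  v \in partite_cliques (class_edges psi) -> rainbow_clique t c (v @: setT).
Proof.
move=> /class_edgesP[vinj vpsi].
rewrite /rainbow_clique card_imset // cardsT card_ord eqxx /=.
apply/forall_inP => e /edgesP[_ [_ [/imsetP[i _ ->] /imsetP[j _ ->] ij ->]]].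
apply/forall_inP => f /edgesP[_ [_ [/imsetP[i' _ ->] /imsetP[j' _ ->] ij' ->]]].
apply/implyP => /eqP cE.
have : psi (colour [set v i; v j]) = psi (colour [set v i'; v j']).
  by rewrite /colour cE.
rewrite !vpsi; first by case/set2_eq => -[-> ->] //; rewrite setUC.
- by apply: contraNneq ij' => ->.
- by apply: contraNneq ij => ->.
Qed.

(** The two images are rainbow and share an edge, hence are equal as sets. The labellings agree too:
    if [v k = v' l], the edge from this vertex to [v i] is sent both to [[set k; i]] and to
    [[set l; i]]. *)
Lemma class_cliques_unique psi (v v' : {ffun 'I_t -> 'I_n}) (w : 'I_t * 'I_t) :
  v \in partite_cliques (class_edges psi) ->
  v' \in partite_cliques (class_edges psi) ->
  w.1 < w.2 -> v w.1 = v' w.1 -> v w.2 = v' w.2 -> v = v'.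
Proof.
case: w => i j /= vT vT' ij vi vj.
have [vinj vpsi] := class_edgesP vT; have [vinj' vpsi'] := class_edgesP vT'.
have imE : v @: setT = v' @: setT.
  apply/eqP; apply: contraT => ne.
  have /negP[] := ag (clique_image_rainbow vT) (clique_image_rainbow vT') ne.
  apply/existsP; exists [set v i; v j].
  apply/andP; split; apply/edgesP; exists (v i), (v j).
    by split; rewrite ?imset_f // (inj_eq vinj) neq_ltn ij.
  by split; rewrite ?(inj_eq vinj) ?neq_ltn ?ij // ?vi ?vj imset_f.
apply/ffunP => k; have [->//|ki] := eqVneq k i.
have : v k \in v' @: setT by rewrite -imE imset_f.
case/imsetP => l _ vkl; rewrite vkl; congr (v' _).
have li : l != i.
  by apply: contraNneq ki => li; apply/eqP/vinj; rewrite vkl li vi.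
have : psi (colour [set v k; v i]) = psi (colour [set v' l; v' i]).
  by rewrite vkl vi.
rewrite vpsi // vpsi' // => /set2_eq[[]//|[ki' _]].
by rewrite ki' eqxx in ki.
Qed.

Lemma set_listing (S : {set 'I_n}) : #|S| = t ->
  exists v : {ffun 'I_t -> 'I_n}, injective v /\ v @: setT = S.
Proof.
move=> St; have [f fS finj] : exists2 f : 'I_t -> 'I_n,
    forall i, f i \in S & injective f.
  exists (fun i => enum_val (cast_ord (esym St) i)) => [i|i j].
    exact: enum_valP.
  by move/enum_val_inj/cast_ord_inj.
have inj : injective [ffun i => f i] by move=> i j; rewrite !ffunE => /finj.
exists [ffun i => f i]; split=> //.
apply/eqP; rewrite eqEcard card_imset // cardsT card_ord St leqnn andbT.
by apply/subsetP => _ /imsetP[i _ ->]; rewrite ffunE.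
Qed.

Definition class_clique_sets psi : {set {set 'I_n}} :=
  [set v @: setT | v : {ffun 'I_t -> 'I_n} in partite_cliques (class_edges psi)].

(** The edges of a rainbow [S] have distinct colours, so [psi] can be prescribed on them without
    conflict; [t ^ 2] is a crude bound on their number. *)
Lemma many_classes S : rainbow_clique t c S ->
  #|{set 'I_t}| ^ palette <=
  #|[set psi | S \in class_clique_sets psi]| * #|{set 'I_t}| ^ (t ^ 2).
Proof.
case/andP => /eqP St rb; have [v [vinj vS]] := set_listing St.
pose col (w : 'I_t * 'I_t) := colour [set v w.1; v w.2].
pose W := [set w : 'I_t * 'I_t | w.1 < w.2].
(* [set0] is a filler for colours that do not occur on the listed edges. *)
pose h y := if [pick w in W | col w == y] is Some w then [set w.1; w.2] else set0.
have hcol w : w \in W -> h (col w) = [set w.1; w.2].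
  move=> wW; rewrite /h; case: pickP => [w' /andP[wW' /eqP E]|/(_ w)]; last first.
    by rewrite wW eqxx.
  have edge u : u \in W -> [set v u.1; v u.2] \in edges_of S.
    rewrite inE => u12; apply/edgesP; exists (v u.1), (v u.2).
    by split; rewrite -?vS ?imset_f // (inj_eq vinj) neq_ltn u12.
  move/forall_inP: rb => /(_ _ (edge _ wW')) /forall_inP /(_ _ (edge _ wW)).
  rewrite (colour_inj E) eqxx => /eqP/set2_eq.
  by case=> -[/vinj -> /vinj ->] //; rewrite setUC.
have := card_prescribed (col @: W) h; rewrite card_ord => /leq_trans; apply.
apply: leq_mul; last first.
  rewrite leq_pexp2l //; first by apply/card_gt0P; exists set0.
  apply: leq_trans (leq_imset_card _ _) _; apply: leq_trans (max_card _) _.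
  by rewrite card_prod !card_ord.
apply: subset_leq_card; apply/subsetP => psi; rewrite !inE => /forall_inP psiP.
apply/imsetP; exists v => //; rewrite inE; apply/forallP => w; apply/implyP => w12.
have wW : w \in W by rewrite inE.
rewrite /class_edges (inj_eq vinj) neq_ltn w12 /= -(hcol _ wW).
exact/psiP/imset_f.
Qed.

(** Double counting of the pairs of a map [psi] and a rainbow clique it keeps: each clique is kept
    by a fixed proportion of the maps, so some map keeps that proportion of the cliques. *)
Lemma good_class : exists psi,
  num_rainbow t c <= #|partite_cliques (class_edges psi)| * #|{set 'I_t}| ^ (t ^ 2).
Proof.
set W := _ ^ (t ^ 2).
pose R := [set S : {set 'I_n} | rainbow_clique t c S].
suff [psi h] : exists psi, #|R| <= #|[set S in R | S \in class_clique_sets psi]| * W.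
  exists psi; apply: leq_trans h _; apply: leq_mul => //.
  apply: (@leq_trans #|class_clique_sets psi|); last exact: leq_imset_card.
  apply: subset_leq_card.
  by apply/subsetP => S; rewrite inE => /andP[].
apply/existsP; apply: contraT; rewrite negb_exists => /forallP small.
pose Psi := {ffun 'I_palette -> {set 'I_t}}.
have : \sum_(psi : Psi) #|[set S in R | S \in class_clique_sets psi]| * W <
       \sum_(psi : Psi) #|R|.
  (* Strictness of the sum requires a term to exist; the constant map to [set0] is split off to
     provide it. *)
  rewrite (bigD1 [ffun=> set0]) //= [X in _ < X](bigD1 [ffun=> set0]) //=.
  rewrite -addSn leq_add //; first by rewrite ltnNge small.
  by apply: leq_sum => psi _; rewrite ltnW // ltnNge small.
rewrite ltnNge sum_nat_const card_ffun card_ord => /negP[].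
rewrite -big_distrl /=.
have -> : \sum_(psi : Psi) #|[set S in R | S \in class_clique_sets psi]| =
          \sum_(S in R) #|[set psi | S \in class_clique_sets psi]|.
  rewrite (eq_bigr (fun psi : Psi =>
    \sum_(S | (S \in R) && (S \in class_clique_sets psi)) 1)); last first.
    by move=> psi _; rewrite sum1dep_card.
  rewrite (exchange_big_dep (mem R)) /=; last by move=> psi S _ /andP[].
  apply: eq_bigr => S SR; rewrite -sum1dep_card; apply: eq_bigl => psi.
  by rewrite (SR : S \in R).
rewrite mulnC -sum_nat_const big_distrl /=; apply: leq_sum => S.
by rewrite inE; exact: many_classes.
Qed.

End UpperBound.

Lemma rainbow_upper_bound (t q : nat) : 3 <= t -> 0 < q ->
  exists N, forall n (c : {set 'I_n} -> nat), N <= n -> almost_gallai t c ->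
  num_rainbow t c * q <= n ^ 2.
Proof.
move=> t3 q0; pose W := #|{set 'I_t}| ^ (t ^ 2).
have W0 : 0 < W by rewrite expn_gt0; apply/orP; left; apply/card_gt0P; exists set0.
have Wq0 : 0 < W * q by rewrite muln_gt0 W0.
have [N NP] := few_partite_cliques t3 Wq0.
exists N => n c nN ag; have [psi le] := good_class t c.
have := NP 'I_n (class_edges psi); rewrite card_ord => /(_ nN)
  /(_ (class_cliques_unique ag (psi := psi))).
by apply: leq_trans; rewrite mulnA leq_mul.
Qed.

(** * Lower bound *)

Section Sphere.
Local Open Scope ring_scope.
Variable k : nat.
Implicit Types a b c x y z : 'I_k -> int.

(** Let [P] and [Q] be the squared distances from [c] to [a] and [b]. The relation makes [a - c] and
    [b - c] proportional, so [al ^+ 2 * P = be ^+ 2 * Q]; its inner product with [c], with all norms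
    equal, gives [al * P + be * Q = 0]. Together they yield [be * ga * Q = 0]. *)
Lemma sphere_no_affine_triple (al be ga r : int) a b c :
  al + be + ga = 0 -> al != 0 -> be != 0 -> ga != 0 ->
  (forall s, al * a s + be * b s + ga * c s = 0) ->
  \sum_s a s ^+ 2 = r -> \sum_s b s ^+ 2 = r -> \sum_s c s ^+ 2 = r ->
  (forall s, a s = c s) /\ (forall s, b s = c s).
Proof.
move=> s0 al0 be0 ga0 lin ra rb rc.
have gaE : ga = - al - be by rewrite -[LHS]subr0 -s0; ring.
pose P := \sum_s (a s - c s) ^+ 2; pose Q := \sum_s (b s - c s) ^+ 2.
have e1 : al ^+ 2 * P = be ^+ 2 * Q.
  rewrite !mulr_sumr; apply: eq_bigr => s _; rewrite -!exprMn.
  have -> : al * (a s - c s) = - (be * (b s - c s)).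
    apply/eqP; rewrite -subr_eq0; apply/eqP.
    by rewrite -[RHS](lin s) gaE; ring.
  by rewrite sqrrN.
have e2 : al * P + be * Q = 0.
  have : \sum_s (al * a s + be * b s + ga * c s) * c s = 0.
    by rewrite big1 // => s _; rewrite lin mul0r.
  have -> : \sum_s (al * a s + be * b s + ga * c s) * c s =
     al * (\sum_s a s * c s) + be * (\sum_s b s * c s) + ga * r.
    rewrite -rc !mulr_sumr -!big_split /=.
    by apply: eq_bigr => s _; ring.
  have PE : P = r *+ 2 - (\sum_s a s * c s) *+ 2.
    rewrite mulr2n -{1}ra -rc -big_split -sumrMnl -sumrB /=.
    by apply: eq_bigr => s _; ring.
  have QE : Q = r *+ 2 - (\sum_s b s * c s) *+ 2.
    rewrite mulr2n -{1}rb -rc -big_split -sumrMnl -sumrB /=.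
    by apply: eq_bigr => s _; ring.
  rewrite PE QE gaE => h.
  have -> : forall u v, al * (r *+ 2 - u *+ 2) + be * (r *+ 2 - v *+ 2) =
     - ((al * u + be * v + (- al - be) * r) *+ 2) by move=> u v; ring.
  by rewrite h mul0rn oppr0.
have Q0 : Q = 0.
  have : be * ga * Q = 0.
    have -> : be * ga * Q = al ^+ 2 * P - be ^+ 2 * Q - al * (al * P + be * Q).
      by rewrite gaE; ring.
    by rewrite e1 e2 subrr mulr0 subr0.
  by move/eqP; rewrite !mulf_eq0 (negPf be0) (negPf ga0) => /eqP.
have P0 : P = 0.
  by move/eqP: e2; rewrite Q0 mulr0 addr0 mulf_eq0 (negPf al0) => /eqP.
have sq0 (u : 'I_k -> int) : \sum_s u s ^+ 2 = 0 -> forall s, u s = 0.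
  move=> /eqP; rewrite psumr_eq0; last by move=> s _; exact: sqr_ge0.
  move=> /allP h s; have := h s (mem_index_enum _).
  by rewrite /= sqrf_eq0 => /eqP.
by split=> s; apply/eqP; rewrite -subr_eq0; apply/eqP;
  [exact: (sq0 (fun s => a s - c s)) | exact: (sq0 (fun s => b s - c s))].
Qed.

End Sphere.

(** * Colourings from triangle-free line systems *)

Section LineSystem.
Variables (V L : finType) (t : nat) (pt : L -> 'I_t -> V).

Definition partite_points := forall l l' i j, pt l i = pt l' j -> i = j.

Definition triangle_free := forall l l' l'' i j k,
  i != j -> j != k -> i != k ->
  pt l i = pt l' i -> pt l' j = pt l'' j -> pt l'' k = pt l k ->
  l = l' /\ l = l''.

End LineSystem.

Section Colouring.
Variables (n t : nat) (L : finType) (pt : L -> 'I_t -> 'I_n).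
Hypothesis t4 : 4 <= t.
Hypothesis ptP : partite_points pt.
Hypothesis tri : triangle_free pt.

Let t0 : 'I_t := Ordinal (leq_trans (isT : 0 < 4) t4).
Let t1 : 'I_t := Ordinal (leq_trans (isT : 1 < 4) t4).

Let base : {set 'I_t} := [set t0; t1].

(** A pair of vertices on no common line falls back to [base]. For the others the choice made by
    [pick] is immaterial, since [partite_points] lets a point determine its index. *)
Definition pair_of (e : {set 'I_n}) : {set 'I_t} :=
  if [pick w : L * ('I_t * 'I_t) |
       (w.2.1 != w.2.2) && (e == [set pt w.1 w.2.1; pt w.1 w.2.2])]
  is Some w then [set w.2.1; w.2.2] else base.

Definition line_colouring (e : {set 'I_n}) : nat :=
  index (pair_of e) (enum [set s : {set 'I_t} | #|s| == 2]).

Lemma base_card : #|base| = 2.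
Proof. by rewrite cards2. Qed.

Lemma pair_of_card e : #|pair_of e| = 2.
Proof.
rewrite /pair_of; case: pickP => [w /andP[w12 _]|_]; last exact: base_card.
by rewrite cards2 w12.
Qed.

Lemma line_colouring_inj e e' :
  line_colouring e = line_colouring e' -> pair_of e = pair_of e'.
Proof.
have mem e'' : pair_of e'' \in enum [set s : {set 'I_t} | #|s| == 2].
  by rewrite mem_enum inE pair_of_card.
by move=> h; rewrite -(nth_index set0 (mem e)) -(nth_index set0 (mem e')); congr nth.
Qed.

Lemma pair_of_line l i j : i != j -> pair_of [set pt l i; pt l j] = [set i; j].
Proof.
move=> ij; rewrite /pair_of; case: pickP => [[l' [a b]] /andP[/= ab /eqP]|].
  by case/set2_eq => -[/ptP -> /ptP ->] //; rewrite setUC.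
by move=> /(_ (l, (i, j))); rewrite /= ij eqxx.
Qed.

Lemma pair_of_cases e : pair_of e = base \/
  exists l i j, [/\ i != j, e = [set pt l i; pt l j] & pair_of e = [set i; j]].
Proof.
rewrite /pair_of; case: pickP => [[l' [a b]] /andP[/= ab /eqP ->]|]; last by left.
by right; exists l', a, b.
Qed.

Definition line_set l : {set 'I_n} := pt l @: setT.

Lemma pt_inj l : injective (pt l).
Proof. by move=> i j /ptP. Qed.

Lemma line_set_card l : #|line_set l| = t.
Proof. by rewrite card_imset ?cardsT ?card_ord //; exact: pt_inj. Qed.

Lemma line_rainbow l : rainbow_clique t line_colouring (line_set l).
Proof.
rewrite /rainbow_clique line_set_card eqxx /=.
apply/forallP => e; apply/implyP => /edgesP[x [y [xl yl xy ->]]].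
apply/forallP => f; apply/implyP => /edgesP[x' [y' [xl' yl' xy' ->]]].
apply/implyP => /eqP/line_colouring_inj.
case/imsetP: xl xy => i _ ->; case/imsetP: yl => j _ -> ij.
case/imsetP: xl' xy' => i' _ ->; case/imsetP: yl' => j' _ -> ij'.
rewrite !pair_of_line; first by case/set2_eq => -[-> ->] //; rewrite setUC.
- by apply: contraNneq ij' => ->.
- by apply: contraNneq ij => ->.
Qed.

(** A [t]-clique has as many edges as there are pairs of indices, so [pair_of], injective on the
    edges of a rainbow clique, is onto. *)
Lemma rainbow_pairs S : rainbow_clique t line_colouring S ->
  forall i j : 'I_t, i != j ->
  exists x y, [/\ x \in S, y \in S, x != y & pair_of [set x; y] = [set i; j]].
Proof.
case/andP => /eqP St rb i j ij.
have inj : {in edges_of S &, injective pair_of}.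
  move=> e f eS fS h; move/forall_inP: rb => /(_ e eS) /forall_inP /(_ f fS).
  by rewrite /line_colouring h eqxx => /eqP.
have sub : pair_of @: edges_of S = [set s : {set 'I_t} | #|s| == 2].
  apply/eqP; rewrite eqEcard; apply/andP; split.
    by apply/subsetP => _ /imsetP[e _ ->]; rewrite inE pair_of_card.
  rewrite card_in_imset // card_draws card_ord -St -(cards_draws S 2).
  by apply: subset_leq_card; apply/subsetP => e; rewrite !inE.
have : [set i; j] \in pair_of @: edges_of S by rewrite sub inE cards2 ij.
by case/imsetP => e /edgesP[x [y [xS yS xy ->]]] ->; exists x, y.
Qed.

(** A degenerate triangle, with [l] used twice and any third index [k], already falls under
    [triangle_free]. *)
Lemma same_line l l' i j : i != j -> pt l i = pt l' i -> pt l j = pt l' j ->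
  l = l'.
Proof.
move=> ij h h'.
have [k [ki kj]] : exists k : 'I_t, k != i /\ k != j.
  have : 0 < #|~: [set i; j]|.
    rewrite -(ltn_add2l #|[set i; j]|) cardsC card_ord cards2 ij.
    exact: leq_trans t4.
  by case/card_gt0P => k; rewrite !inE negb_or => /andP[ki kj]; exists k.
have [] // := tri (l'' := l) (k := k) ij _ _ h (esym h') erefl.
- by rewrite eq_sym.
- by rewrite eq_sym.
Qed.

Lemma nonbase_line_edge x y : pair_of [set x; y] != base ->
  exists l i j, [/\ i != j, x = pt l i & y = pt l j].
Proof.
case: (pair_of_cases [set x; y]) => [->|]; first by rewrite eqxx.
case=> l [i [j [ij /set2_eq h _]]] _.
case: h => -[-> ->]; first by exists l, i, j.
by exists l, j, i; rewrite eq_sym.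
Qed.

Lemma rainbow_is_line S : rainbow_clique t line_colouring S ->
  exists l, S = line_set l.
Proof.
move=> rS; have [/eqP St rb] := andP rS.
have inj x y x' y' : x \in S -> y \in S -> x != y -> x' \in S -> y' \in S ->
    x' != y' -> pair_of [set x; y] = pair_of [set x'; y'] ->
    [set x; y] = [set x'; y'].
  move=> xS yS xy xS' yS' xy' h.
  have eS : [set x; y] \in edges_of S by apply/edgesP; exists x, y.
  have fS : [set x'; y'] \in edges_of S by apply/edgesP; exists x', y'.
  move/forall_inP: rb => /(_ _ eS) /forall_inP /(_ _ fS).
  by rewrite /line_colouring h eqxx => /eqP.
(* [[set u; v]] is the only edge of [S] whose pair is [base]; every other edge is a line edge. *)
have [u [v [uS vS uv uvB]]] := rainbow_pairs rS (isT : t0 != t1).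
have other x y : x \in S -> y \in S -> x != y -> [set x; y] != [set u; v] ->
  exists l i j, [/\ i != j, x = pt l i & y = pt l j].
  move=> xS yS xy ne; apply: nonbase_line_edge.
  by apply: contraNneq ne => h; apply/eqP; apply: inj; rewrite // h uvB.
have [w [wS wu wv]] : exists w, [/\ w \in S, w != u & w != v].
  have : 0 < #|S :\: [set u; v]|.
    rewrite cardsD St subn_gt0 (leq_ltn_trans (subset_leq_card (subsetIr _ _))) //.
    by rewrite cards2 uv; exact: leq_trans t4.
  by case/card_gt0P => w; rewrite !inE negb_or => /andP[/andP[? ?] ?]; exists w.
(* The three edges on [w], [x] and [y] are line edges: indices match at the shared vertices, and
   [triangle_free] merges the three lines. *)
have key x y : x \in S -> y \in S -> x != w -> y != w -> x != y ->
    [set x; y] != [set u; v] ->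
    exists l i j k, [/\ [/\ i != j, j != k & i != k],
       w = pt l k, x = pt l i & y = pt l j].
  move=> xS yS xw yw xy ne.
  have nex z : [set z; w] != [set u; v].
    apply: contraNneq wu => h.
    have : w \in [set u; v] by rewrite -h set22.
    by rewrite !inE (negPf wv) orbF.
  have [l [i [k [ik xE wE]]]] := other x w xS wS xw (nex _).
  have [l' [j [k' [jk yE wE']]]] := other y w yS wS yw (nex _).
  have [l'' [i' [j' [ij xE' yE']]]] := other x y xS yS xy ne.
  have ? : k' = k by apply: (ptP (l := l') (l' := l)); rewrite -wE' -wE.
  have ? : i' = i by apply: (ptP (l := l'') (l' := l)); rewrite -xE' -xE.
  have ? : j' = j by apply: (ptP (l := l'') (l' := l')); rewrite -yE' -yE.
  subst k' i' j'.
  have [|||h1 h2] := tri (l := l) (l' := l'') (l'' := l') ij jk ik.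
  - by rewrite -xE.
  - by rewrite -yE'.
  - by rewrite -wE'.
  by exists l, i, j, k; split=> //; rewrite h2.
(* Now [z] and [w] both avoid the exceptional edge, which takes four vertices, so every triangle on
   [z] and [w] consists of line edges. *)
have [z [zS zw zu zv]] : exists z, [/\ z \in S, z != w, z != u & z != v].
  have : 0 < #|S :\: (w |: [set u; v])|.
    rewrite cardsD St subn_gt0 (leq_ltn_trans (subset_leq_card (subsetIr _ _))) //.
    by rewrite cardsU1 cards2 uv; apply: leq_trans t4; case: (_ \notin _).
  case/card_gt0P => z; rewrite !inE !negb_or => /andP[/andP[? /andP[? ?]] ?].
  by exists z.
have nez x : [set z; x] != [set u; v].
  apply: contraNneq zu => h.
  have : z \in [set u; v] by rewrite -h set21.
  by rewrite !inE (negPf zv) orbF.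
have [l [iz [iw [izw zE wE]]]] := other z w zS wS zw (nez w).
exists l; apply/eqP; rewrite eqEcard line_set_card St leqnn andbT.
apply/subsetP => x xS.
have [->|xw] := eqVneq x w; first by rewrite wE imset_f.
have [->|xz] := eqVneq x z; first by rewrite zE imset_f.
have zx : z != x by rewrite eq_sym.
have [l' [i [j [k [[ij jk ik] wE' zE' ->]]]]] := key z x zS xS zw xw zx (nez x).
have ? : k = iw by apply: (ptP (l := l') (l' := l)); rewrite -wE' -wE.
have ? : i = iz by apply: (ptP (l := l') (l' := l)); rewrite -zE' -zE.
subst k i.
have -> : l' = l by apply: (same_line izw); rewrite -?wE' -?zE' -?wE -?zE.
by rewrite imset_f.
Qed.

Lemma line_almost_gallai : almost_gallai t line_colouring.
Proof.
move=> S S' /rainbow_is_line[l ->] /rainbow_is_line[l' ->].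
apply: contra => /existsP[e /andP[/edgesP[x [y [xl yl xy ->]]]]].
case/edgesP => x' [y' [xl' yl' xy' exy]].
case/imsetP: xl xy exy => i _ ->; case/imsetP: yl => j _ -> ij.
case/imsetP: xl' xy' => i' _ ->; case/imsetP: yl' => j' _ -> ij'.
have {}ij : i != j by apply: contraNneq ij => ->.
case/set2_eq => -[h h'].
- have ? := ptP h; have ? := ptP h'; subst i' j'.
  by rewrite (same_line ij h h').
- have ? := ptP h; have ? := ptP h'; subst i' j'.
  by rewrite (same_line ij h h').
Qed.

Lemma line_num_colours : num_colours line_colouring <= 'C(t, 2).
Proof.
rewrite -[X in _ <= X](size_iota 0); apply: uniq_leq_size; first exact: undup_uniq.
move=> y; rewrite mem_undup => /mapP[e _ ->]; rewrite mem_iota /= add0n.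
rewrite -[t in 'C(t, 2)]card_ord -card_draws cardE /line_colouring index_mem.
by rewrite mem_enum inE pair_of_card.
Qed.

Lemma line_num_rainbow : #|L| <= num_rainbow t line_colouring.
Proof.
rewrite -(card_imset (mem L) (f := line_set)).
  apply: subset_leq_card; apply/subsetP => _ /imsetP[l _ ->].
  by rewrite inE line_rainbow.
move=> l l' h; apply: (same_line (isT : t0 != t1)).
  have : pt l t0 \in line_set l' by rewrite -h imset_f.
  by case/imsetP => i _ h'; rewrite h' -(ptP h').
have : pt l t1 \in line_set l' by rewrite -h imset_f.
by case/imsetP => i _ h'; rewrite h' -(ptP h').
Qed.

End Colouring.


(** * Lines in a box with directions on a sphere *)

Section SphereSystem.
Variables (n t k d r : nat).
Hypothesis big_n : t * (t * d) ^ k <= n.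

Definition sphere : {set {ffun 'I_k -> 'I_d}} :=
  [set a : {ffun 'I_k -> 'I_d} | \sum_s a s ^ 2 == r].

Definition sphere_lines : finType :=
  ({ffun 'I_k -> 'I_d} * {a : {ffun 'I_k -> 'I_d} | a \in sphere})%type.

Lemma line_coord_lt (i : 'I_t) (x a : 'I_d) : x + i * a < t * d.
Proof. have := ltn_ord i; have := ltn_ord x; have := ltn_ord a; nia. Qed.

(** Storing the index [i] in the point makes the system partite. *)
Definition line_coord (l : sphere_lines) (i : 'I_t) :
    'I_t * {ffun 'I_k -> 'I_(t * d)} :=
  (i, [ffun s => Ordinal (line_coord_lt i (l.1 s) (val l.2 s))]).

Lemma card_coord : #|{: 'I_t * {ffun 'I_k -> 'I_(t * d)}}| <= n.
Proof. by rewrite card_prod card_ffun !card_ord. Qed.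

Definition line_point (l : sphere_lines) (i : 'I_t) : 'I_n :=
  widen_ord card_coord (enum_rank (line_coord l i)).

Lemma line_point_inj l l' i j : line_point l i = line_point l' j ->
  i = j /\ forall s, l.1 s + i * val l.2 s = l'.1 s + j * val l'.2 s.
Proof.
move=> /(congr1 val) /= /val_inj /enum_rank_inj [-> /ffunP h]; split=> // s.
by have := h s; rewrite !ffunE => -[].
Qed.

Lemma line_point_partite : partite_points line_point.
Proof. by move=> l l' i j /line_point_inj[]. Qed.

(** Adding the three incidences cancels the starting points and leaves a relation between the
    directions whose coefficients sum to zero. *)
Lemma affine_relation (i j m a a' a'' x x' x'' : nat) :
  x + i * a = x' + i * a' -> x' + j * a' = x'' + j * a'' ->
  x'' + m * a'' = x + m * a ->
  ((Posz i - Posz m) * Posz a + (Posz j - Posz i) * Posz a'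
    + (Posz m - Posz j) * Posz a'' = 0)%R.
Proof. by lia. Qed.

(** Distinct indices make the three coefficients nonzero, so [sphere_no_affine_triple] identifies
    the directions; lines with equal direction that meet at a common index then start at the same
    point. *)
Lemma line_point_triangle_free : triangle_free line_point.
Proof.
move=> l l' l'' i j m ij jm im /line_point_inj[_ h1] /line_point_inj[_ h2].
move=> /line_point_inj[_ h3].
pose z (a : {ffun 'I_k -> 'I_d}) s : int := Posz (a s).
have norm (a : {a | a \in sphere}) : (\sum_s z (val a) s ^+ 2 = Posz r)%R.
  have := valP a; rewrite inE => /eqP <-.
  rewrite -[RHS]natz natr_sum; apply: eq_bigr => s _.
  by rewrite natrX natz.
have neq (a b : 'I_t) : a != b -> (Posz a - Posz b != 0)%R.
  by rewrite subr_eq0.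
have [||||||||h4 h5] := @sphere_no_affine_triple k (Posz i - Posz m)%R
  (Posz j - Posz i)%R (Posz m - Posz j)%R (Posz r)
  (z (val l.2)) (z (val l'.2)) (z (val l''.2)).
- by ring.
- exact: neq.
- by apply: neq; rewrite eq_sym.
- by apply: neq; rewrite eq_sym.
- move=> s; exact: (affine_relation (h1 s) (h2 s) (h3 s)).
- exact: norm.
- exact: norm.
- exact: norm.
have eqa (a b : {a | a \in sphere}) : (forall s, z (val a) s = z (val b) s) ->
    a = b.
  by move=> h; apply/val_inj/ffunP => s; apply/val_inj; have [] := h s.
have e1 := eqa _ _ h4; have e2 := eqa _ _ h5.
case: l l' l'' h1 h2 h3 e1 e2 {h4 h5} => x a [x' a'] [x'' a''] /= h1 h2 h3 ??.
subst a a'; split; congr (_, _); apply/ffunP => s; apply/val_inj => /=.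
  by have := h1 s; lia.
by have := h3 s; lia.
Qed.

Lemma card_sphere_lines : #|sphere_lines| = d ^ k * #|sphere|.
Proof. by rewrite card_prod card_ffun !card_ord card_sig. Qed.

End SphereSystem.

(** Pigeonhole over the [k * d ^ 2] possible squared norms. *)
Lemma large_sphere (k d : nat) : 0 < k -> 0 < d ->
  exists r, d ^ k <= #|sphere k d r| * (k * d ^ 2).
Proof.
move=> k0 d0.
have normlt (a : {ffun 'I_k -> 'I_d}) : \sum_s a s ^ 2 < k * d ^ 2.
  apply: (@leq_ltn_trans (\sum_(s < k) d.-1 ^ 2)).
    by apply: leq_sum => s _; rewrite leq_sqr -ltnS prednK.
  rewrite sum_nat_const card_ord ltn_pmul2l // ltn_sqr.
  by rewrite prednK.
pose N : {ffun 'I_k -> 'I_d} -> 'I_(k * d ^ 2) := fun a => Ordinal (normlt a).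
case: (boolP [exists r : 'I_(k * d ^ 2), d ^ k <= #|sphere k d r| * (k * d ^ 2)]).
  by case/existsP => r h; exists r.
rewrite negb_exists => /forallP small; exfalso.
have : #|{: {ffun 'I_k -> 'I_d}}| = \sum_(r < k * d ^ 2) #|sphere k d r|.
  rewrite -sum1_card (partition_big N xpredT) //=; apply: eq_bigr => r _.
  rewrite sum1_card; apply: eq_card => a.
  by rewrite inE unfold_in.
rewrite card_ffun !card_ord => tot.
have K0 : 0 < k * d ^ 2 by rewrite muln_gt0 k0 expn_gt0 d0.
have : d ^ k * (k * d ^ 2) < d ^ k * (k * d ^ 2).
  rewrite {1}tot big_distrl /= -[X in _ < X]mulnC.
  rewrite -[X in _ < X * _]card_ord -sum_nat_const.
  have : 0 < #|'I_(k * d ^ 2)| by rewrite card_ord.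
  case/card_gt0P => r0 _.
  rewrite (bigD1 r0) //= [X in _ < X](bigD1 r0) //= -addSn leq_add //.
    by rewrite ltnNge small.
  by apply: leq_sum => r _; rewrite ltnW // ltnNge small.
by rewrite ltnn.
Qed.

Lemma many_rainbow_nat (t k n d : nat) : 4 <= t -> 0 < k -> 0 < d ->
  t * (t * d) ^ k <= n ->
  exists c : {set 'I_n} -> nat,
    [/\ almost_gallai t c, num_colours c <= 'C(t, 2) &
        d ^ k * d ^ k <= num_rainbow t c * (k * d ^ 2)].
Proof.
move=> t4 k0 d0 big_n; have [r hr] := large_sphere k0 d0.
have part := @line_point_partite n t k d r big_n.
have tri := @line_point_triangle_free n t k d r big_n.
exists (line_colouring (line_point (r := r) big_n) t4); split.
- exact: line_almost_gallai.
- exact: line_num_colours.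
apply: leq_trans (leq_mul (line_num_rainbow t4 part tri) (leqnn _)).
by rewrite card_sphere_lines -mulnA leq_mul.
Qed.

Lemma rainbow_lower_bound (t : nat) (eps : R) : 4 <= t -> Rlt 0 eps ->
  exists N : nat, forall n : nat, N <= n ->
  exists c : {set 'I_n} -> nat,
    [/\ almost_gallai t c, num_colours c <= 'C(t, 2) &
        Rle (Rpower (INR n) (Rminus 2 eps)) (INR (num_rainbow t c))].
Proof.
move=> t4 eps0; have t0 : 0 < t by exact: leq_trans t4.
have [k [k3 keps]] := INR_mul_ge 4 eps0.
have k0 : 0 < k by exact: leq_trans k3.
(* The factor 2 in [C] absorbs [d.+1 <= 2 * d]; beyond the scale [d1] the condition [C * k <= d]
   holds. *)
pose C := t * (t * 2) ^ k; pose d1 := C * k.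
have C0 : 0 < C by rewrite muln_gt0 t0 expn_gt0 muln_gt0 t0.
(* From this size on, the largest scale [d] that fits exceeds [d1]. *)
exists (t * (t * d1.+1) ^ k) => n nN.
have [d [dn nd]] := largest_scale n t0 k0.
have d1d : d1 < d.
  by have := leq_ltn_trans nN nd; rewrite ltn_pmul2l // ltn_exp2r // ltn_pmul2l.
have d0 : 0 < d by exact: leq_ltn_trans d1d.
have [c [ag nc cnt]] := many_rainbow_nat t4 k0 d0 dn.
exists c; split=> //; apply: (rainbow_count_bound (C := C) _ C0 d0 _ k3 keps _ cnt).
- by apply: leq_trans nN; rewrite muln_gt0 t0 expn_gt0 muln_gt0 t0.
- exact: ltnW.
apply: leq_trans (ltnW nd) _; rewrite /C -mulnA leq_pmul2l // -expnMn leq_exp2r //.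
by rewrite -mulnA leq_pmul2l // mul2n -addnn -addn1 leq_add2l.
Qed.

Theorem theorem1p1 :
  (* (i) tau_t(n) = o(n^2) for every fixed t >= 3 *)
  (forall t : nat, 3 <= t ->
     forall eps : R, Rlt 0 eps ->
       exists N : nat, forall n : nat, N <= n ->
         forall c : {set 'I_n} -> nat, almost_gallai t c ->
           Rle (INR (num_rainbow t c)) (Rmult eps (pow (INR n) 2)))
  /\
  (* (ii) + moreover: tau_t(n) >= n^(2-o(1)) for every fixed t >= 4, attained by
     almost t-Gallai colourings using only 'C(t,2) colours *)
  (forall t : nat, 4 <= t ->
     forall eps : R, Rlt 0 eps ->
       exists N : nat, forall n : nat, N <= n ->
         exists c : {set 'I_n} -> nat,
           [/\ almost_gallai t c, num_colours c <= 'C(t, 2) &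
               Rle (Rpower (INR n) (Rminus 2 eps)) (INR (num_rainbow t c))]).
Proof.
split=> t ht eps eps0; last exact: rainbow_lower_bound.
have [q [q3 qe]] := INR_mul_ge 1 eps0.
have [N NP] := rainbow_upper_bound ht (leq_trans (isT : 0 < 3) q3).
exists N => n nN c ag; apply: (INR_le_eps_sqr qe); exact: NP.
Qed.
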